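(* Let $M$ be a 1-motive defined over $K\subseteq\mathbb{C}$ and $M^*$ its Cartier dual. For the periods matrices $\Pi_M$ and $\Pi_{M^*}$ computed with respect to the dual bases chosen in the context, one has $\Pi_{M^*}=(2\mathrm{i}\pi\,\Pi_M^{-1})^t$. In particular $\det(\Pi_M)=\pm(2\mathrm{i}\pi)^{g+s}$ and $\det(\Pi_{M^*})=\pm(2\mathrm{i}\pi)^{n+g}$.
   Context: Data. $M=[u:X\to G]$ is a 1-motive over $K\subseteq\mathbb{C}$: $X$ a Galois module free of rank $n$ over $\mathbb{Z}$, $\pi:G\to A$ an extension of a $g$-dimensional abelian variety $A$ by an $s$-dimensional torus $Y(1)$ with character group $Y^\vee$. Bases of $X$ and $Y^\vee$ determine points $P_1,\dots,P_n\in A$, $Q_1,\dots,Q_s\in A^*$ (the dual of $A$, the $Q_k$ parametrizing $G$), and $R_i=u(x_i)\in G$ above $P_i$. The Cartier dual is $M^*=[u^*:Y^\vee\to G^*]$, with $G^*$ the extension of $A^*$ by the torus with character group $X$ parametrized by $P_1,\dots,P_n$, and $R_k^*=u^*(y_k^\vee)\in G^*$ above $Q_k$; $u$ and $u^*$ correspond to the same biadditive trivialization of the pull-back of the Poincaré biextension to $X\times Y^\vee$. Theta functions. Up to isogeny $A$ has a principal polarization $H$. Write $A(\mathbb{C})=\mathbb{C}^g/\Lambda$. Identify the dual $A^*(\mathbb{C})=\mathrm{Hom}_{\overline{\mathbb{C}}}(\mathbb{C}^g,\mathbb{C})/\Lambda^*$ (antilinear forms; $\Lambda^*=\{\lambda^*:\mathrm{Im}\,\lambda^*(\Lambda)\subset\mathbb{Z}\}$)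 with $\mathbb{C}^g/\phi_H^{-1}(\Lambda^* )$ via $\phi_H(z)=H(z,\cdot)$. Let $\theta$ be a theta function with first Chern class $H$ (functional equation $\theta(z+\lambda)=\chi(\lambda)e^{\pi H(z,\lambda)+\frac{\pi}{2}H(\lambda,\lambda)}\theta(z)$, $\chi$ a semi-character), with $\theta(0)=1$ and $d\log\theta(0)=0$. Put $d\log\theta=\sum_j h_j\,dz_j$ and $F_q(z)=\frac{\theta(z+q)}{\theta(z)\theta(q)}e^{-\sum_j h_j(q)z_j}$. Let $\omega_j=dz_j$, and let $\eta_j$ be the differential of the second kind with $\exp_A^*\eta_j=dh_j$. Fix logarithms $p_i\in\mathbb{C}^g$ of $P_i$ and $q_k\in\mathbb{C}^g$ with $\phi_H(q_k)$ a logarithm of $Q_k$; the theta values occurring are assumed nonzero. Differentials of the third kind. $\xi_{Q_k}$ is the form on $A$ whose pull-back to $\mathbb{C}^g$ is $d\log F_{q_k}$. $\tilde\xi_{Q_k}$ is the pull-back of $dZ_k/Z_k$ by the rational map $G\cong A\times\mathbb{G}_m^s\to\mathbb{G}_m$ (projection to the $k$-th factor), where the exponential of the push-out $G_{Q_k}$ is $(z,t)\mapsto(\exp_A(z),e^tF_{q_k}(z))$. $\xi^G_{Q_k}=-\tilde\xi_{Q_k}+\pi^*\xi_{Q_k}$ is an invariant differential on $G$. The form $\xi^{G^*}_{P_i}$ on $G^*$ is defined analogously, from $F_{p_i}$ in the variable $q$ on $A^*$. Bases. $\lambda_1,\dots,\lambda_{2g}$ is a basis of $\Lambda$, symplectic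 for $\mathrm{Im}\,H$ (matrix $J=\begin{pmatrix}0&\mathrm{Id}_g\\-\mathrm{Id}_g&0\end{pmatrix}$). $\gamma_1,\dots,\gamma_{2g}$ are loops lifting them in $G$, chosen so that $\int_{\gamma_i}\tilde\xi_{Q_k}=0$ (same convention for $G^*$). $\delta_k$ are loops in $\mathbb{G}_m^s$ with $\int_{\delta_k}\xi^G_{Q_l}=2\mathrm{i}\pi$ if $k=l$ and $0$ otherwise. $df_i$ are exact forms with $f_i(R_j)-f_i(O)=1$ if $i=j$ and $0$ otherwise. The starred objects $\delta_i^*$ and $df_k^*$ are the analogues for $M^*$. Paths $[O,R_i]$, $[O,R_k^*]$ lift to paths from $0$ to logarithms of $R_i=(P_i,e^{\ell_{i,1}},\dots,e^{\ell_{i,s}})$ and $R_k^*=(Q_k,e^{\ell_{1,k}},\dots,e^{\ell_{n,k}})$, with the same $\ell_{i,k}$. The bases of the Hodge and De Rham realizations of $M$ are $([O,R_1],\dots,[O,R_n],\gamma_1,\dots,\gamma_{2g},\delta_1,\dots,\delta_s)$ and $(\xi^G_{Q_1},\dots,\xi^G_{Q_s},\pi^*\omega_1,\dots,\pi^*\omega_g,\pi^*\eta_1,\dots,\pi^*\eta_g,df_1,\dots,df_n)$. The dual bases for $M^*$ are $(\delta_1^*,\dots,\delta_n^*,-\gamma_{g+1},\dots,-\gamma_{2g},\gamma_1,\dots,\gamma_g,-[O,R_1^*],\dots,-[O,R_s^*])$ and $(-df_1^*,\dots,-df_s^*,-\pi^*\eta_1,\dots,-\pi^*\eta_g,\pi^*\omega_1,\dots,\pi^*\omega_g,\xi^{G^*}_{P_1},\dots,\xi^{G^*}_{P_n})$.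 Periods matrices. With respect to these bases $$\Pi_M=\begin{pmatrix}\Xi_R&\widetilde{\log}_A(P)&\mathrm{Id}_n\\\Upsilon_Q&\Pi_A&0\\2\mathrm{i}\pi\,\mathrm{Id}_s&0&0\end{pmatrix},\qquad\Pi_{M^*}=\begin{pmatrix}0&0&2\mathrm{i}\pi\,\mathrm{Id}_n\\0&\Pi_{A^*}&\Upsilon_P\\\mathrm{Id}_s&\widetilde{\log}_{A^*}(Q)&\Xi_{R^*}\end{pmatrix},$$ where, with $\Omega_1=(\int_z^{\lambda_i+z}\omega_j)$, $\Omega_2=(\int_z^{\lambda_{g+i}+z}\omega_j)$, $N_1=(\int_z^{\lambda_i+z}\eta_j)$, $N_2=(\int_z^{\lambda_{g+i}+z}\eta_j)$ ($i,j\le g$), $$\Pi_A=\begin{pmatrix}\Omega_1&N_1\\\Omega_2&N_2\end{pmatrix},\qquad\Pi_{A^*}=\begin{pmatrix}N_2&-\Omega_2\\-N_1&\Omega_1\end{pmatrix},$$ $\widetilde{\log}_A(P)=\big(\int_z^{p_i+z}\omega_j,\int_z^{p_i+z}\eta_j\big)_{i,j}$, $\widetilde{\log}_{A^*}(Q)=\big(\int_z^{q_k+z}\eta_j,-\int_z^{q_k+z}\omega_j\big)_{k,j}$, $\Upsilon_Q=(\int_{\gamma_i}\xi^G_{Q_k})_{i\le2g,k\le s}$, $\Upsilon_P=\begin{pmatrix}-\int_{\gamma_{g+j}}\xi^{G^*}_{P_i}\\\int_{\gamma_j}\xi^{G^*}_{P_i}\end{pmatrix}_{j\le g,\,i\le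 n}$, $\Xi_R=(\int_O^{R_i}\xi^G_{Q_k})_{i,k}$, $\Xi_{R^*}=(-\int_O^{R_k^*}\xi^{G^*}_{P_i})_{k,i}$. Conventions for integrals along open paths. They are understood in the sense of generalized logarithms, i.e. after modifying the forms in their classes by exact forms so that $\int_z^{p+z}\eta_j=h_j(p)$, $\int_O^{R_i}\xi^G_{Q_k}=\log F_{q_k}(p_i)-\ell_{i,k}$ and $\int_O^{R_k^*}\xi^{G^*}_{P_i}=\log F_{p_i}(q_k)-\ell_{i,k}$. Logarithms are taken with compatible branches, i.e. so that $\log\frac{F_{q_k}(\lambda_i+z)}{F_{q_k}(z)}=\pi H(q_k,\lambda_i)-\sum_jh_j(q_k)\int_z^{\lambda_i+z}\omega_j$ (and likewise for $F_{p_i}$), and $\log F_{q_k}(p_i)-\log F_{p_i}(q_k)=\sum_j\big(h_j(p_i)(q_k)_j-h_j(q_k)(p_i)_j\big)$. *)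

(* Defs.v *)
From HB Require Import structures.
From mathcomp Require Import all_boot all_order all_algebra.
From mathcomp Require Import complex.
From mathcomp Require Import all_classical all_reals all_analysis.

Set Implicit Arguments.
Unset Strict Implicit.
Unset Printing Implicit Defensive.

Import Order.TTheory GRing.Theory Num.Theory.
Import numFieldNormedType.Exports.

Local Open Scope classical_set_scope.
Local Open Scope ring_scope.
Local Open Scope complex_scope.

(* The complex numbers, with the topology of their norm; row vectors over them
   are then normed spaces over [Cx R], so that [differentiable] and ['D_v f]
   are complex differentiability. *)
Definition Cx (R : realType) : numClosedFieldType := R[i].

Section ComplexAnalysis.
Variable R : realType.
Local Notation C := (Cx R).

Definition cexp (z : C) : C :=
  (expR (complex.Re z) * cos (complex.Im z))
    +i* (expR (complex.Re z) * sin (complex.Im z)).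

Definition twoipi : C := 0 +i* (2 * pi).

Section Forms.
Variable m : nat.
Local Notation V := 'rV[C]_m.

Definition partial (j : 'I_m) (f : V -> C) (z : V) : C :=
  'D_(delta_mx 0 j) f z.

(* All iterated complex partial derivatives are complex differentiable near z.
   By Cauchy's theorem this is the same as f being complex differentiable
   near z. *)
Definition holomorphic_at (f : V -> C) (z : V) : Prop :=
  \forall y \near z, forall js : seq 'I_m, differentiable (foldr partial f js) y.

(* A 1-form is the function giving its coefficients on dz_1, ..., dz_m. *)
Definition oneform : Type := V -> V.

Definition dform (f : V -> C) : oneform := fun z => \row_j partial j f z.

Definition dlog (f : V -> C) : oneform := fun z => (f z)^-1 *: dform f z.

Definition C1_path (c : R -> V) : Prop :=
  forall j : 'I_m,
    let x t := complex.Re (c t 0 j) in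
    let y t := complex.Im (c t 0 j) in
    [/\ forall t, derivable x t 1, forall t, derivable y t 1,
        continuous (derive1 x) & continuous (derive1 y)].

Definition velocity (c : R -> V) (t : R) : V :=
  \row_j (derive1 (fun u => complex.Re (c u 0 j)) t
            +i* derive1 (fun u => complex.Im (c u 0 j)) t).

(* A path is the restriction to [0, 1] of a C1 curve. *)
Definition path_integral (c : R -> V) (a : oneform) : C :=
  let phi t : C := \sum_j a (c t) 0 j * velocity c t 0 j in
  (\int[lebesgue_measure]_(t in `[0, 1]) complex.Re (phi t))
    +i* (\int[lebesgue_measure]_(t in `[0, 1]) complex.Im (phi t)).

Definition chain : Type := int * (R -> V).

Definition chain_integral (c : chain) (a : oneform) : C :=
  path_integral c.2 a *~ c.1.

End Forms.
End ComplexAnalysis.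

Definition Jmx (R : realType) (g : nat) : 'M[R]_(g + g) :=
  block_mx 0 1%:M (- 1%:M) 0.

Definition int_span (R : realType) (g : nat)
    (lam : 'I_(g + g) -> 'rV[Cx R]_g) : set 'rV[Cx R]_g :=
  [set v | exists a : 'I_(g + g) -> int, v = \sum_i lam i *~ a i].

(* A complex torus C^g / Lambda with a symplectic basis of Lambda, a principal
   polarization [herm] (linear in the first variable, antilinear in the second)
   and a normalized theta function for it. *)
Record polarized_torus (R : realType) (g : nat) := PolarizedTorus {
  lam : 'I_(g + g) -> 'rV[Cx R]_g;
  herm : {dot 'rV[Cx R]_g for Num.conj};
  chi : 'rV[Cx R]_g -> Cx R;
  theta : 'rV[Cx R]_g -> Cx R;
  lam_basis : forall z : 'rV[Cx R]_g,
    exists! a : 'rV[R]_(g + g), z = \sum_i (a 0 i)%:C *: lam i;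
  lam_symplectic : forall i j,
    complex.Im (herm (lam i) (lam j)) = Jmx R g i j;
  chi_norm : forall l, int_span lam l -> `|chi l| = 1;
  chiD : forall l l', int_span lam l -> int_span lam l' ->
    chi (l + l')
    = chi l * chi l' * cexp (0 +i* (pi * complex.Im (herm l l')));
  theta_entire : forall z, holomorphic_at theta z;
  theta_period : forall z l, int_span lam l ->
    theta (z + l)
    = chi l * cexp (pi%:C * herm z l + (pi / 2)%:C * herm l l) * theta z;
  theta0 : theta 0 = 1;
  dtheta0 : dlog theta 0 = 0
}.

Section Torus.
Variables (R : realType) (g : nat) (A : polarized_torus R g).
Local Notation C := (Cx R).
Local Notation V := 'rV[C]_g.

Definition lattice : set V := int_span (lam A).

Definition phiH (z : V) : V -> C := fun w => herm A z w.

(* The lattice Lambda^* of the dual torus, made of antilinear forms. *)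
Definition dual_lattice : set (V -> C) :=
  [set f | (forall (a : C) u v, f (a *: u + v) = a^* * f u + f v) /\
           (forall l, lattice l -> exists k : int, complex.Im (f l) = k%:~R)].

Lemma Im_herm_suml (a : 'I_(g + g) -> R) (w : V) :
  complex.Im (herm A (\sum_i (a i)%:C *: lam A i) w)
  = \sum_i a i * complex.Im (herm A (lam A i) w).
Proof.
transitivity (complex.Im (\sum_i ((a i)%:C * herm A (lam A i) w) : C)).
  congr complex.Im; rewrite linear_sumlz; apply: eq_bigr => i _.
  exact: linearZl_LR.
rewrite (raddf_sum (@complex.Im R : {additive R[i] -> R})).
apply: eq_bigr => i _.
by case: (herm A (lam A i) w) => x y /=; rewrite mul0r addr0.
Qed.

Lemma Im_herm_sumr (b : 'I_(g + g) -> int) (z : V) :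
  complex.Im (herm A z (\sum_i lam A i *~ b i))
  = \sum_i complex.Im (herm A z (lam A i)) *~ b i.
Proof.
transitivity (complex.Im (\sum_i (herm A z (lam A i) *~ b i) : C)).
  by congr complex.Im; rewrite linear_sumr; apply: eq_bigr => i _; rewrite raddfMz.
rewrite (raddf_sum (@complex.Im R : {additive R[i] -> R})).
by apply: eq_bigr => i _; rewrite (raddfMz (@complex.Im R : {additive R[i] -> R})).
Qed.

Lemma sum_Jmx (a : 'I_(g + g) -> R) (k : 'I_g) :
  \sum_i a i * Jmx R g i (lshift g k) = - a (rshift g k) /\
  \sum_i a i * Jmx R g i (rshift g k) = a (lshift g k).
Proof.
split; rewrite big_split_ord /=.
- rewrite big1 ?add0r => [|i _]; last by rewrite block_mxEul mxE mulr0.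
  rewrite (bigD1 k) //= big1 ?addr0 => [|i ik].
    by rewrite block_mxEdl !mxE eqxx mulrN1.
  by rewrite block_mxEdl !mxE (negPf ik) oppr0 mulr0.
- rewrite [X in _ + X]big1 ?addr0 => [|i _]; last by rewrite block_mxEdr mxE mulr0.
  rewrite (bigD1 k) //= big1 ?addr0 => [|i ik].
    by rewrite block_mxEur !mxE eqxx mulr1.
  by rewrite block_mxEur !mxE (negPf ik) mulr0.
Qed.

Lemma Jmx_int (i j : 'I_(g + g)) : exists k : int, Jmx R g i j = k%:~R.
Proof.
rewrite /Jmx -(splitK i) -(splitK j).
case: (fintype.split i) => i'; case: (fintype.split j) => j' /=.
- by exists 0; rewrite block_mxEul mxE.
- by exists (i' == j')%:Z; rewrite block_mxEur mxE; case: (_ == _).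
- by exists (- (i' == j')%:Z); rewrite block_mxEdl !mxE mulrNz; case: (_ == _).
- by exists 0; rewrite block_mxEdr mxE.
Qed.

(* As the polarization is principal, phiH identifies the dual torus with
   C^g / Lambda itself. *)
Lemma preimage_dual_lattice : phiH @^-1` dual_lattice = lattice.
Proof.
apply/seteqP; split=> z /=.
- case=> _ Hz; have [a [za _]] := lam_basis A z.
  have lamL j : lattice (lam A j).
    exists (fun i => (i == j)%:Z); rewrite (bigD1 j) //= eqxx big1 ?addr0 //.
    by move=> i /negPf ->.
  have HJ j : exists k : int, \sum_i a 0 i * Jmx R g i j = k%:~R.
    have [k Hk] := Hz _ (lamL j); exists k; rewrite -Hk /phiH [in RHS]za.
    by rewrite Im_herm_suml; apply: eq_bigr => i _; rewrite lam_symplectic.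
  have aZ i : exists k : int, a 0 i = k%:~R.
    rewrite -(splitK i); case: (fintype.split i) => k /=.
    + have [m Hm] := HJ (rshift g k); exists m.
      by rewrite -Hm (sum_Jmx _ k).2.
    + have [m Hm] := HJ (lshift g k); exists (- m).
      by rewrite mulrNz -Hm (sum_Jmx _ k).1 opprK.
  have [b Hb] := choice aZ.
  exists b; rewrite {1}za; apply: eq_bigr => i _.
  by rewrite Hb (rmorph_int (real_complex R)) scaler_int.
- case=> b zb; split=> [a u v|l [c ->]].
    by rewrite /phiH linearPr.
  rewrite Im_herm_sumr.
  have zb' : z = \sum_i ((b i)%:~R : R)%:C *: lam A i.
    rewrite {1}zb; apply: eq_bigr => i _.
    by rewrite (rmorph_int (real_complex R)) scaler_int.
  have imZ j : exists k : int, complex.Im (herm A z (lam A j)) = k%:~R.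
    rewrite zb' (Im_herm_suml (fun i => (b i)%:~R)).
    have JZ i := Jmx_int i j; have [k Hk] := choice JZ.
    exists (\sum_i b i * k i); rewrite rmorph_sum; apply: eq_bigr => i _.
    by rewrite lam_symplectic Hk rmorphM.
  have [d Hd] := choice imZ.
  exists (\sum_j d j * c j); rewrite rmorph_sum; apply: eq_bigr => j _.
  by rewrite Hd rmorphM /= mulrzr.
Qed.

Definition hlog (j : 'I_g) (z : V) : C := dlog (theta A) z 0 j.

Definition Ftheta (q z : V) : C :=
  theta A (z + q) / (theta A z * theta A q) * cexp (- \sum_j hlog j q * z 0 j).

Definition omega (j : 'I_g) : oneform R g := dform (fun z => z 0 j).
Definition eta (j : 'I_g) : oneform R g := dform (hlog j).
Definition xi (q : V) : oneform R g := dlog (Ftheta q).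

End Torus.

(* A 1-motive u : Z^n -> G over the complex numbers, with fixed logarithms:
   [plog i] is a logarithm of P_i, [phiH (qlog k)] is a logarithm of Q_k, and
   R_i = (P_i, coord i 0, ..., coord i (s - 1)) in the birational
   trivialization A x G_m^s of G; [coord] is the trivialization of the
   pull-back of the Poincare biextension. *)
Record one_motive (R : realType) (g : nat) (A : polarized_torus R g)
    (n s : nat) := OneMotive {
  plog : 'I_n -> 'rV[Cx R]_g;
  qlog : 'I_s -> 'rV[Cx R]_g;
  coord : 'M[Cx R]_(n, s);
  coord_neq0 : forall i k, coord i k != 0;
  theta_plog : forall i, theta A (plog i) != 0;
  theta_qlog : forall k, theta A (qlog k) != 0;
  theta_pqlog : forall i k, theta A (plog i + qlog k) != 0
}.

Lemma theta_qplog (R : realType) (g : nat) (A : polarized_torus R g)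
    (n s : nat) (M : one_motive A n s) k i :
  theta A (qlog M k + plog M i) != 0.
Proof. by rewrite addrC theta_pqlog. Qed.

Lemma coordT_neq0 (R : realType) (g : nat) (A : polarized_torus R g)
    (n s : nat) (M : one_motive A n s) k i : (coord M)^T k i != 0.
Proof. by rewrite mxE coord_neq0. Qed.

(* The torus underlying M^* is the dual of A, which phiH identifies with
   C^g / Lambda (preimage_dual_lattice). The loops of the dual lifting the
   basis of its lattice are therefore again indexed by [lam A]. *)
Definition cartier_dual (R : realType) (g : nat) (A : polarized_torus R g)
    (n s : nat) (M : one_motive A n s) : one_motive A s n :=
  OneMotive (coordT_neq0 M) (theta_qlog M) (theta_plog M) (theta_qplog M).

Section Extension.
Variables (R : realType) (g : nat) (A : polarized_torus R g) (n s : nat).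
Variable M : one_motive A n s.
Local Notation C := (Cx R).

(* Forms and functions on G are pulled back to Lie G = C^g x C^s, with
   coordinates (z, t), by the exponential
   (z, t) |-> (exp_A z, (e^{t_k} F_{q_k}(z))_k). *)
Local Notation LieG := 'rV[C]_(g + s).

Definition zpart (v : LieG) : 'rV[C]_g := lsubmx v.
Definition tpart (v : LieG) (k : 'I_s) : C := rsubmx v 0 k.

Definition pull (a : oneform R g) : oneform R (g + s) :=
  fun v => row_mx (a (zpart v)) 0.

Definition Zcoord (k : 'I_s) (v : LieG) : C :=
  cexp (tpart v k) * Ftheta A (qlog M k) (zpart v).

Definition xi_tilde (k : 'I_s) : oneform R (g + s) := dlog (Zcoord k).

Definition xiG (k : 'I_s) : oneform R (g + s) :=
  fun v => - xi_tilde k v + pull (xi A (qlog M k)) v.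

(* Points above which the birational trivialization of G is regular. *)
Definition generic (v : LieG) : Prop :=
  theta A (zpart v) != 0 /\ forall k, theta A (zpart v + qlog M k) != 0.

Definition exp_kernel : set LieG :=
  [set w | lattice A (zpart w) /\
           forall v k, generic v -> Zcoord k (v + w) = Zcoord k v].

(* Choices entering the period matrix: the logarithms ell_{i,k} of the
   coordinates of the R_i, the logarithms of the F_{q_k}(p_i), lifts to Lie G
   of the paths gamma_i, delta_k, [O, R_i], and the functions f_i on G, seen as
   functions on Lie G invariant under the kernel of the exponential. *)
Record period_data := PeriodData {
  ell : 'M[C]_(n, s);
  logF : 'M[C]_(n, s);
  gam : 'I_(g + g) -> R -> LieG;
  del : 'I_s -> R -> LieG;
  opn : 'I_n -> R -> LieG;
  fex : 'I_n -> LieG -> C;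
  exp_ell : forall i k, cexp (ell i k) = coord M i k;
  exp_logF : forall i k, cexp (logF i k) = Ftheta A (qlog M k) (plog M i);

  gam_C1 : forall i, C1_path (gam i);
  gam_generic : forall i t, t \in `[0, 1] -> generic (gam i t);
  gam_lift : forall i, zpart (gam i 1) - zpart (gam i 0) = lam A i;
  gam_loop : forall i, exp_kernel (gam i 1 - gam i 0);
  gam_xi_tilde : forall i k, path_integral (gam i) (xi_tilde k) = 0;
  (* the branch of log (F_{q_k}(lambda_i + z) / F_{q_k}(z)) *)
  gam_branch : forall i k,
    path_integral (gam i) (pull (xi A (qlog M k)))
    = pi%:C * herm A (qlog M k) (lam A i)
      - \sum_j hlog A j (qlog M k) * path_integral (gam i) (pull (omega j));

  del_C1 : forall k, C1_path (del k);
  del_torus : forall k t, t \in `[0, 1] -> zpart (del k t) = 0;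
  del_loop : forall k, exp_kernel (del k 1 - del k 0);
  del_xiG : forall k l,
    path_integral (del k) (xiG l) = if k == l then twoipi R else 0;

  opn_C1 : forall i, C1_path (opn i);
  opn_generic : forall i t, t \in `[0, 1] -> generic (opn i t);
  opn_start : forall i, opn i 0 = 0;
  (* the end point is the logarithm of R_i with
     e^{t_k} F_{q_k}(p_i) = e^{ell_{i,k}} *)
  opn_endz : forall i, zpart (opn i 1) = plog M i;
  opn_endt : forall i k, tpart (opn i 1) k = ell i k - logF i k;

  fex_periodic : forall i v w, exp_kernel w -> fex i (v + w) = fex i v;
  fex_gam : forall i j t, t \in `[0, 1] -> holomorphic_at (fex i) (gam j t);
  fex_del : forall i k t, t \in `[0, 1] -> holomorphic_at (fex i) (del k t);
  fex_opn : forall i j t, t \in `[0, 1] -> holomorphic_at (fex i) (opn j t);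
  fex_dual : forall i j, fex i (opn j 1) - fex i 0 = (i == j)%:R
}.

Variable D : period_data.

Definition basis_chain (i : 'I_(n + (g + g) + s)) : chain R (g + s) :=
  match fintype.split i with
  | inl i' => match fintype.split i' with
              | inl a => (1, opn D a)
              | inr b => (1, gam D b)
              end
  | inr k => (1, del D k)
  end.

Definition basis_form (j : 'I_(s + (g + g) + n)) : oneform R (g + s) :=
  match fintype.split j with
  | inl j' => match fintype.split j' with
              | inl k => xiG k
              | inr b => match fintype.split b with
                         | inl a => pull (omega a)
                         | inr a => pull (eta A a)
                         end
              end
  | inr i => dform (fex D i)
  end.

(* The dual bases, for a motive playing the role of M^*. *)
Definition dual_basis_chain (i : 'I_(s + (g + g) + n)) : chain R (g + s) :=
  match fintype.split i with
  | inl i' => match fintype.split i' with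
              | inl k => (1, del D k)
              | inr b => match fintype.split b with
                         | inl a => (- 1, gam D (rshift g a))
                         | inr a => (1, gam D (lshift g a))
                         end
              end
  | inr a => (- 1, opn D a)
  end.

Definition dual_basis_form (j : 'I_(n + (g + g) + s)) : oneform R (g + s) :=
  match fintype.split j with
  | inl j' => match fintype.split j' with
              | inl i => fun v => - dform (fex D i) v
              | inr b => match fintype.split b with
                         | inl a => fun v => - pull (eta A a) v
                         | inr a => pull (omega a)
                         end
              end
  | inr k => xiG k
  end.

End Extension.

Lemma block_swap (n m s : nat) : (s + m + n = n + m + s)%N.
Proof. by rewrite addnC addnA addnAC (addnAC n m s). Qed.

Section PeriodMatrices.
Variables (R : realType) (g : nat) (A : polarized_torus R g) (n s : nat).

Definition period_matrix (M : one_motive A n s) (D : period_data M) :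
    'M[Cx R]_(n + (g + g) + s) :=
  \matrix_(i, j) chain_integral (basis_chain D i)
    (basis_form D (cast_ord (esym (block_swap n (g + g) s)) j)).

Definition dual_period_matrix (M' : one_motive A s n) (D' : period_data M') :
    'M[Cx R]_(n + (g + g) + s) :=
  \matrix_(i, j) chain_integral (dual_basis_chain D' i)
    (dual_basis_form D' (cast_ord (esym (block_swap n (g + g) s)) j)).

(* The choices for M and M^* involve the same ell_{i,k} and compatible
   branches of log F_{q_k}(p_i) and log F_{p_i}(q_k). *)
Definition compatible_data (M : one_motive A n s) (D : period_data M)
    (D' : period_data (cartier_dual M)) : Prop :=
  (forall i k, ell D' k i = ell D i k) /\
  (forall i k,
     logF D i k - logF D' k i
     = \sum_j (hlog A j (plog M i) * qlog M k 0 j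
               - hlog A j (qlog M k) * plog M i 0 j)).

End PeriodMatrices.

(* Main.v *)
(** Every entry of the two period matrices is an integral along a C1 path of a
    form which, on the path, is exact or a combination of known periods: on
    generic points xi_tilde_k = dt_k + d log F_{q_k}, hence xi^G_k = - dt_k, and
    the remaining forms are dz_j, dh_j and df_i. The functional equation of theta
    gives h_j(z + l) = h_j(z) + pi H(e_j, l), so that the periods of eta_j are
    pi H(e_j, lambda_i).

    Up to a common permutation of the columns the period matrices are block
    triangular, and Pi_M Pi_{M*}^T = 2 i pi Id splits into four block identities.
    The one for Pi_A is Legendre's relation, which holds since
    H(lambda_i, lambda_k) - H(lambda_k, lambda_i) = 2 i Im H(lambda_i, lambda_k);
    the mixed ones express H(v, lambda_i) in coordinates, and the last one is the
    compatibility of the logarithms. As Pi_{A*} = J Pi_A J^T, Legendre's relation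
    also gives det(Pi_A)^2 = (2 i pi)^{2 g}. *)

Require Import Defs.
From HB Require Import structures.
From mathcomp Require Import all_boot all_order all_algebra.
From mathcomp Require Import fingroup perm.
From mathcomp Require Import complex.
From mathcomp Require Import all_classical all_reals all_analysis.
From mathcomp Require Import ring lra zify.

Set Implicit Arguments.
Unset Strict Implicit.
Unset Printing Implicit Defensive.

Import Order.TTheory GRing.Theory Num.Theory.
Import numFieldNormedType.Exports.

Local Open Scope classical_set_scope.
Local Open Scope ring_scope.
Local Open Scope complex_scope.

(** * Complex numbers and the exponential *)

Section ComplexTopology.
Variable R : realType.
Local Notation C := (Cx R).

(* Resolution does not find [nbhs_pfilter] by itself through [Cx]. *)
Global Instance Cx_nbhs_filter (z : C) : ProperFilter (nbhs z).
Proof. exact: nbhs_pfilter. Qed.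

Lemma ReD (a b : C) : complex.Re (a + b) = complex.Re a + complex.Re b.
Proof. by case: a b => [? ?] []. Qed.
Lemma ImD (a b : C) : complex.Im (a + b) = complex.Im a + complex.Im b.
Proof. by case: a b => [? ?] []. Qed.
Lemma ReN (a : C) : complex.Re (- a) = - complex.Re a.
Proof. by case: a. Qed.
Lemma ImN (a : C) : complex.Im (- a) = - complex.Im a.
Proof. by case: a. Qed.
Lemma ReZ (x : R) (a : C) : complex.Re (x%:C * a) = x * complex.Re a.
Proof. by case: a => ? ? /=; rewrite mul0r subr0. Qed.
Lemma ImZ (x : R) (a : C) : complex.Im (x%:C * a) = x * complex.Im a.
Proof. by case: a => ? ? /=; rewrite mul0r addr0. Qed.

Lemma normc_ge_Im (z : C) : `|complex.Im z|%:C <= `|z|.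
Proof.
case: z => a b; rewrite normc_def lecR /= -sqrtr_sqr ler_wsqrtr //.
by rewrite lerDr sqr_ge0.
Qed.

Lemma normc_real (x : R) : `|x%:C : C| = `|x|%:C.
Proof. by rewrite normc_def /= expr0n addr0 sqrtr_sqr. Qed.

Lemma normc_im (x : R) : `|(0 +i* x) : C| = `|x|%:C.
Proof. by rewrite normc_def /= expr0n add0r sqrtr_sqr. Qed.

Lemma normc_le_ReIm (z : C) : `|z| <= `|complex.Re z|%:C + `|complex.Im z|%:C.
Proof.
case: z => a b /=; have -> : (a +i* b : C) = a%:C + (0 +i* b).
  by congr Complex; rewrite /= ?addr0 ?add0r.
by rewrite (le_trans (ler_normD _ _)) // normc_real normc_im.
Qed.

Lemma posc_real (e : C) : 0 < e -> e = (complex.Re e)%:C /\ 0 < complex.Re e.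
Proof.
by case: e => a b; rewrite ltcE /= => /andP[/eqP -> a0].
Qed.

Lemma continuous_Re : continuous (fun z : C => complex.Re z).
Proof.
move=> z; apply/cvgrPdist_lt => e e0; apply/nbhs_normP.
exists e%:C => [|w /= zw]; first by rewrite /= ltcR.
by rewrite -ltcR -ReN -ReD (le_lt_trans (normc_ge_Re _)).
Qed.

Lemma continuous_Im : continuous (fun z : C => complex.Im z).
Proof.
move=> z; apply/cvgrPdist_lt => e e0; apply/nbhs_normP.
exists e%:C => [|w /= zw]; first by rewrite /= ltcR.
by rewrite -ltcR -ImN -ImD (le_lt_trans (normc_ge_Im _)).
Qed.

Lemma continuous_realC : continuous (fun x : R => x%:C : C).
Proof.
move=> x; apply/cvgrPdist_lt => e /posc_real[-> e0]; apply/nbhs_normP.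
by exists (complex.Re e) => // y /= xy; rewrite -rmorphB normc_real ltcR.
Qed.

Lemma cvg_complex {T : Type} {F : set_system T} {FF : Filter F} (u v : T -> R)
    x y :
  u @ F --> x -> v @ F --> y ->
  (fun t => u t +i* v t : C) @ F --> (x +i* y : C).
Proof.
move=> ux vy.
have E a b : (a +i* b : C) = a%:C + (0 +i* 1) * b%:C.
  by rewrite [RHS]/GRing.add /=; congr Complex; rewrite /=;
     rewrite ?mul0r ?mul1r ?mulr0 ?subr0 ?addr0 ?add0r.
rewrite E; under eq_fun do rewrite E.
apply: cvgD; last apply: cvgM; first last.
- exact: cvg_comp vy (@continuous_realC _).
- exact: cvg_cst.
- exact: cvg_comp ux (@continuous_realC _).
Qed.

Lemma cexpD (z w : C) : cexp (z + w) = cexp z * cexp w.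
Proof.
case: z w => [a b] [c d]; rewrite /cexp /= expRD cosD sinD.
by rewrite [RHS]/GRing.mul /=; congr Complex; ring.
Qed.

Lemma cexp0 : cexp 0 = 1 :> C.
Proof. by rewrite /cexp /= expR0 cos0 sin0 mulr1 mulr0. Qed.

Lemma cexp_neq0 (z : C) : cexp z != 0.
Proof.
apply/eqP => z0; have := cexpD z (- z).
by rewrite subrr cexp0 z0 mul0r => /eqP; rewrite oner_eq0.
Qed.

End ComplexTopology.

(** Multiplying the estimate of the difference quotient by [|h|] makes it hold at [h = 0] too. A
    full neighbourhood is needed: it is pulled back along [Re] and [Im], which vanish at some
    nonzero complex numbers. *)
Lemma is_derive0_near (K : numFieldType) (f : K -> K) (d e : K) :
  is_derive (0 : K) (1 : K) f d -> 0 < e ->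
  \forall h \near 0, `|f h - f 0 - d * h| <= e * `|h|.
Proof.
case=> df <- e0.
have /cvgrPdist_le/(_ e e0) :
  (fun h : K => h^-1 *: (f (h *: 1 + 0) - f 0)) @ 0^' --> 'D_1 f 0 := df.
move=> /nbhs_ballP[r /= r0 H]; apply/nbhs_ballP; exists r => // h hr.
have [->|h0] := eqVneq h 0; first by rewrite subrr mulr0 subr0 normr0 mulr0.
have := H h hr h0; rewrite /= addr0 [_ *: 1]mulr1 => {}H.
rewrite -ler_pdivrMr ?normr_gt0 // -normfV -normrM -normrN.
rewrite (le_trans _ H) // le_eqVlt; apply/orP; left; apply/eqP; congr `|_|.
rewrite /GRing.scale /=; field; exact: h0.
Qed.

(** * The complex derivative of the exponential *)

Section CexpDerivative.
Variable R : realType.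
Local Notation C := (Cx R).

(** The parts [e^x cos y] and [e^x sin y] are expanded separately; their errors, at most
    [3 * e * |h|] and [4 * e * |h|], add up to the constant 7. *)
Lemma cexp_near0 (e : R) : 0 < e -> e <= 1 ->
  \forall h \near (0 : C), `|cexp h - 1 - h| <= (7 * e)%:C * `|h|.
Proof.
move=> e0 e1.
have E := is_derive0_near (is_derive_expR (0 : R)) e0.
have S := is_derive0_near (is_derive_sin (0 : R)) e0.
have Co := is_derive0_near (is_derive_cos (0 : R)) e0.
have RR : \forall h \near (0 : C),
    `|expR (complex.Re h) - 1 - complex.Re h| <= e * `|complex.Re h|.
  apply: (@filterS _ (nbhs (0 : C)) _ _ _ _ (@continuous_Re R 0 _ E)) => h /=.
  by rewrite expR0 mul1r.
have IS : \forall h \near (0 : C),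
    `|sin (complex.Im h) - complex.Im h| <= e * `|complex.Im h|.
  apply: (@filterS _ (nbhs (0 : C)) _ _ _ _ (@continuous_Im R 0 _ S)) => h /=.
  by rewrite sin0 cos0 subr0 mul1r.
have IC : \forall h \near (0 : C),
    `|cos (complex.Im h) - 1| <= e * `|complex.Im h|.
  apply: (@filterS _ (nbhs (0 : C)) _ _ _ _ (@continuous_Im R 0 _ Co)) => h /=.
  by rewrite sin0 cos0 oppr0 mul0r subr0.
(* Smallness of [x = Re h] absorbs the second order term [x * sin y] and bounds [|1 + x|] by 2. *)
have e20 : 0 < e / 2 by rewrite divr_gt0.
have R1 : \forall h \near (0 : C), `|complex.Re h| < e / 2.
  have := @continuous_Re R 0 => /cvgrPdist_lt /(_ (e / 2) e20) /=.
  by apply: filterS => h; rewrite sub0r normrN.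
near=> h.
have RRh : `|expR (complex.Re h) - 1 - complex.Re h| <= e * `|complex.Re h|.
  by near: h.
have ISh : `|sin (complex.Im h) - complex.Im h| <= e * `|complex.Im h|.
  by near: h.
have ICh : `|cos (complex.Im h) - 1| <= e * `|complex.Im h| by near: h.
have R1h : `|complex.Re h| < e / 2 by near: h.
(* The norm of [h] is replaced by a real number, so that the remaining inequalities live in the
   ordered field [R]. *)
have [N N0 hN] : exists2 N : R, 0 <= N & `|h| = N%:C.
  exists (Num.sqrt (complex.Re h ^+ 2 + complex.Im h ^+ 2));
    by rewrite ?sqrtr_ge0 ?normc_def.
have xN : `|complex.Re h| <= N by rewrite -lecR -hN normc_ge_Re.
have yN : `|complex.Im h| <= N by rewrite -lecR -hN normc_ge_Im.
rewrite hN -rmorphM (le_trans (normc_le_ReIm _)) // -rmorphD lecR.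
rewrite !ReD !ReN !ImD !ImN /=.
move: RRh ISh ICh R1h xN yN.
move: (complex.Re h) (complex.Im h) => x y RRh ISh ICh R1h xN yN.
have HR : `|expR x * cos y - 1 - x| <= 3 * e * N.
  have -> : expR x * cos y - 1 - x
      = (expR x - 1 - x) * cos y + (1 + x) * (cos y - 1) by ring.
  rewrite (le_trans (ler_normD _ _)) // !normrM.
  have c1 : `|cos y| <= 1 by rewrite ler_norml cos_geN1 cos_le1.
  have x2 : `|1 + x| <= 2.
    by rewrite (le_trans (ler_normD _ _)) // normr1; lra.
  have := normr_ge0 (cos y - 1); have := normr_ge0 (expR x - 1 - x).
  have := normr_ge0 (cos y); have := normr_ge0 (1 + x).
  nra.
have HI : `|expR x * sin y - y| <= 4 * e * N.
  have -> : expR x * sin y - y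
      = ((expR x - 1 - x) + x) * sin y + (sin y - y) by ring.
  rewrite (le_trans (ler_normD _ _)) // normrM.
  have s2 : `|sin y| <= 2 * `|y|.
    have -> : sin y = (sin y - y) + y by ring.
    by rewrite (le_trans (ler_normD _ _)) //; have := normr_ge0 y; nra.
  have x2 : `|(expR x - 1 - x) + x| <= 3 / 2 * e.
    by rewrite (le_trans (ler_normD _ _)) //; have := normr_ge0 x; nra.
  have := normr_ge0 (sin y); have := normr_ge0 (expR x - 1 - x + x).
  have := normr_ge0 y.
  nra.
rewrite subr0.
lra.
Unshelve. all: by end_near. Qed.

Lemma is_derive_cexp0 : is_derive (0 : C) (1 : C) (@cexp R) 1.
Proof.
have H : (fun h : C => h^-1 *: (cexp (h *: (1 : C) + 0) - cexp 0)) @ 0^'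
    --> (1 : C).
  apply/cvgrPdist_le => e /posc_real[-> e0]; set r := complex.Re e in e0 *.

  (* This meets both constraints: [d <= 1] for [cexp_near0], and [7 * d <= r] for the required
     bound. *)
  pose d := Num.min 1 (r / 7).
  have d0 : 0 < d by rewrite lt_min ltr01 divr_gt0.
  have d1 : d <= 1 by rewrite ge_min lexx.
  have := cexp_near0 d0 d1 => /nbhs_ballP[q /= q0 Hq].
  apply/nbhs_ballP; exists q => // h hq h0 /=.
  have := Hq h hq; rewrite addr0 [_ *: 1]mulr1 cexp0 => {}Hq.
  have -> : 1 - h^-1 *: (cexp h - 1) = - (h^-1 * (cexp h - 1 - h)).
    by rewrite [_ *: _]/(h^-1 * _) [in RHS]mulrBr mulVf // opprB.
  rewrite normrN normrM normfV ler_pdivrMl ?normr_gt0 // mulrC (le_trans Hq) //.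
  rewrite ler_wpM2r // lecR mulrC -ler_pdivlMr // ge_min lexx orbT //.
apply: DeriveDef; first by apply/cvg_ex; exists 1.
exact: cvg_lim.
Qed.

(** By [cexpD] the difference quotient at [z] is [cexp z] times the one at 0. *)
Lemma is_derive_cexp (z : C) : is_derive z (1 : C) (@cexp R) (cexp z).
Proof.
have [/cvg_ex[l Hl] E] := is_derive_cexp0.
have {}El : l = 1 by rewrite -E; apply/esym; exact: cvg_lim Hl.
rewrite {}El {E} in Hl.
have H : (fun h : C => h^-1 *: (cexp (h *: (1 : C) + z) - cexp z)) @ 0^'
    --> (cexp z : C).
  rewrite -[X in _ --> X]mulr1.
  have -> : (fun h : C => h^-1 *: (cexp (h *: (1 : C) + z) - cexp z)) =
    (fun h => cexp z * (h^-1 *: (cexp (h *: (1 : C) + 0) - cexp 0))).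
    apply/funext => h; rewrite addr0 !cexpD cexp0 /GRing.scale /=; ring.
  by apply: cvgM Hl; exact: cvg_cst.
apply: DeriveDef; first by apply/cvg_ex; exists (cexp z).
exact: cvg_lim.
Qed.

Lemma differentiable_cexp (V : normedModType C) (f : V -> C) z :
  differentiable f z -> differentiable (fun y => cexp (f y)) z.
Proof.
move=> df; apply: (@differentiable_comp _ _ _ _ f (@cexp R)) => //.
by apply/derivable1_diffP; case: (is_derive_cexp (f z)).
Qed.

Lemma derive_cexp (V : normedModType C) (f : V -> C) z v :
  differentiable f z -> 'D_v (fun y => cexp (f y)) z = cexp (f z) * 'D_v f z.
Proof.
move=> df; rewrite deriveE; last exact: differentiable_cexp.
have dc : differentiable (@cexp R) (f z).
  by apply/derivable1_diffP; case: (is_derive_cexp (f z)).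
have dz : derivable (@cexp R) (f z) 1 by exact/derivable1_diffP.
rewrite (diff_comp df dc) /= -(deriveE v df).
apply: (etrans (congr1 (@^~ ('D_v f z)) (deriv1E dz))) => /=.
rewrite derive1E (@derive_val _ _ _ _ _ _ _ (is_derive_cexp (f z))).
exact: mulrC.
Qed.

End CexpDerivative.

(** * Integrals along C1 paths *)

Lemma cvg_mx (K : numFieldType) m n (T : Type) (F : set_system T) {FF : Filter F}
    (u : T -> 'M[K]_(m, n)) (A : 'M[K]_(m, n)) :
  (forall i j, (fun t => u t i j) @ F --> A i j) -> u @ F --> A.
Proof.
move=> H; apply/cvg_ballP => e e0.
suff : \forall t \near F, forall i j, ball (A i j) e (u t i j).
  by apply: filterS => t Ht; split.
apply: filter_forall => i; apply: filter_forall => j.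
exact: (cvg_ballP _ _).1 (H i j) _ e0.
Qed.

Section ChainRule.
Variables (R : realType) (m : nat).
Local Notation C := (Cx R).
Local Notation V := 'rV[C]_m.

Lemma diff_partial (f : V -> C) z v : differentiable f z ->
  'd f z v = \sum_j partial j f z * v 0 j.
Proof.
move=> df; rewrite {1}(row_sum_delta v) linear_sum; apply: eq_bigr => j _.
by rewrite linearZ /= /partial deriveE // mulrC.
Qed.

Variable c : R -> V.
Hypothesis c1 : C1_path c.

(** The parameter is real and the values lie in a complex space, hence the scalar [(h^-1)%:C]. The
    limit is taken coordinate by coordinate, on real and imaginary parts. *)
Lemma C1_path_growth t :
  (fun h : R => ((h^-1)%:C : C) *: (c (h + t) - c t)) @ 0^' --> velocity c t.
Proof.
apply: cvg_mx => i j; rewrite (ord1 i) [velocity c t 0 j]mxE.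
have [dx dy _ _] := c1 j.
rewrite (_ : (fun _ => _) = fun h : R =>
   (h^-1 *: (complex.Re (c (h *: 1 + t) 0 j) - complex.Re (c t 0 j))) +i*
   (h^-1 *: (complex.Im (c (h *: 1 + t) 0 j) - complex.Im (c t 0 j)))); last first.
  apply/funext => h; rewrite !mxE [h *: 1]mulr1.
  case: (c (h + t) 0 j) (c t 0 j) => a b [a' b'] /=.
  by congr Complex; rewrite !mul0r ?subr0 ?addr0.
apply: cvg_complex; rewrite derive1E.
- exact: dx.
- exact: dy.
Qed.

Lemma C1_path_continuous : continuous c.
Proof.
move=> t; apply: cvg_mx => i j; rewrite (ord1 i).
have [dx dy _ _] := c1 j.
rewrite (_ : (fun _ => _) = fun u =>
    complex.Re (c u 0 j) +i* complex.Im (c u 0 j)); last first.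
  by apply/funext => u; case: (c u 0 j).
rewrite (_ : c t 0 j = complex.Re (c t 0 j) +i* complex.Im (c t 0 j)); last first.
  by case: (c t 0 j).
apply: cvg_complex.
- apply: (differentiable_continuous (f := fun u => complex.Re (c u 0 j))).
  apply/derivable1_diffP; exact: dx.
- apply: (differentiable_continuous (f := fun u => complex.Im (c u 0 j))).
  apply/derivable1_diffP; exact: dy.
Qed.

Lemma C1_path_velocity_continuous j : continuous (fun t => velocity c t 0 j).
Proof.
have [_ _ cx cy] := c1 j.
move=> t; rewrite /continuous_at mxE (_ : (fun _ => _) = fun u =>
  derive1 (fun u => complex.Re (c u 0 j)) u
  +i* derive1 (fun u => complex.Im (c u 0 j)) u).
  by apply: cvg_complex; [exact: cx | exact: cy].
by apply/funext => u; rewrite mxE.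
Qed.

(** A chain rule between a real path and a complex differential. The quotient is ['d f] applied to
    the quotient [W] of the path, which tends to the velocity, plus a remainder [r] that is
    negligible because [W] stays bounded. *)
Lemma chain_growth (f : V -> C) t : differentiable f (c t) ->
  (fun h : R => ((h^-1)%:C : C) * (f (c (h + t)) - f (c t))) @ 0^'
    --> \sum_j partial j f (c t) * velocity c t 0 j.
Proof.
move=> df; rewrite -diff_partial //.
pose w (h : R) := c (h + t) - c t.
pose W (h : R) := ((h^-1)%:C : C) *: w h.
have W0 : W @ 0^' --> velocity c t := @C1_path_growth t.
have w0 : w @ 0^' --> (0 : V).
  rewrite -(subrr (c t)); apply: cvgB; last exact: cvg_cst.
  have : {for 0, continuous (fun h => c (h + t))}.
    apply: continuous_comp; last by rewrite add0r; exact: C1_path_continuous.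
    by apply: cvgD; [exact: cvg_id | exact: cvg_cst].
  by move/continuous_withinNx; rewrite add0r.
have [dfc _] := (diff_locallyxP _ _).1 df.
have dW : 'd f (c t) (W h) @[h --> 0^'] --> 'd f (c t) (velocity c t).
  apply: (@cvg_comp _ _ _ W ('d f (c t)) _ _ _ W0); exact: dfc.
rewrite -[X in _ --> X]addr0.
pose r (h : R) : C :=
  ((h^-1)%:C : C) * (f (c (h + t)) - f (c t)) - 'd f (c t) (W h).
rewrite (_ : (fun h : R => _) = fun h => 'd f (c t) (W h) + r h); last first.
  by apply/funext => h; rewrite /r [RHS]addrC subrK.
apply: cvgD dW _.
apply/cvgrPdist_le => e e0.
(* [K] bounds [W h] near 0, so a remainder of at most [e / K] times [|w h|] becomes at most [e]
   after division by [h]. *)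
pose K := `|velocity c t| + 1.
have K0 : 0 < K by rewrite ltr_wpDl.
have W1 : \forall h \near (0:R)^', `|W h| <= K.
  have W1 := (cvgrPdist_le _ _).1 W0 1 ltr01; near=> h.
  have Wh : `|velocity c t - W h| <= 1 by near: h; exact: W1.
  rewrite -[W h](subKr (velocity c t)) (le_trans (ler_normB _ _)) //.
  by rewrite lerD2l.
have eK : 0 < e / K by rewrite divr_gt0.
pose d := f \o shift (c t) - (cst (f (c t)) + 'd f (c t)).
have /eqaddoP/(_ _ eK) o1 := diff_locally df.
have {}o1 : \forall h \near (0:R)^', `|d (w h)| <= e / K * `|w h|.
  exact: (w0 _ o1).
near=> h.
rewrite sub0r normrN.
have rE : r h = ((h^-1)%:C : C) * d (w h).
  have -> : d (w h) = f (c (h + t)) - f (c t) - 'd f (c t) (w h).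
    transitivity (f (w h + c t) - (f (c t) + 'd f (c t) (w h))); first by [].
    by rewrite /w subrK opprD addrA.
  have E : 'd f (c t) (W h) = ((h^-1)%:C : C) * 'd f (c t) (w h).
    by rewrite /W linearZ.
  by rewrite /r E [in RHS]mulrBr.
have Wh : `|W h| <= K by near: h; exact: W1.
rewrite rE normrM.
have oh : `|d (w h)| <= e / K * `|w h| by near: h; exact: o1.
rewrite (le_trans (ler_wpM2l (normr_ge0 _) oh)) // mulrCA -normrZ -/(W h).
by rewrite mulrAC ler_pdivrMr // ler_wpM2l // ltW.
Unshelve. all: by end_near. Qed.

Lemma is_derive_Re_path (f : V -> C) t : differentiable f (c t) ->
  is_derive t (1 : R) (fun u => complex.Re (f (c u)))
    (complex.Re (\sum_j partial j f (c t) * velocity c t 0 j)).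
Proof.
move=> df.
have H : (fun h : R => h^-1 *:
    (complex.Re (f (c (h *: 1 + t))) - complex.Re (f (c t)))) @ 0^'
    --> complex.Re (\sum_j partial j f (c t) * velocity c t 0 j).
  rewrite (_ : (fun h : R => _) = fun h : R =>
      complex.Re (((h^-1)%:C : C) * (f (c (h + t)) - f (c t)))).
    by apply: cvg_comp (chain_growth df) _; exact: continuous_Re.
  by apply/funext => h; rewrite ReZ ReD ReN [h *: 1]mulr1.
apply: DeriveDef; last exact: cvg_lim H.
by apply/cvg_ex; eexists; exact: H.
Qed.

Lemma is_derive_Im_path (f : V -> C) t : differentiable f (c t) ->
  is_derive t (1 : R) (fun u => complex.Im (f (c u)))
    (complex.Im (\sum_j partial j f (c t) * velocity c t 0 j)).
Proof.
move=> df.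
have H : (fun h : R => h^-1 *:
    (complex.Im (f (c (h *: 1 + t))) - complex.Im (f (c t)))) @ 0^'
    --> complex.Im (\sum_j partial j f (c t) * velocity c t 0 j).
  rewrite (_ : (fun h : R => _) = fun h : R =>
      complex.Im (((h^-1)%:C : C) * (f (c (h + t)) - f (c t)))).
    by apply: cvg_comp (chain_growth df) _; exact: continuous_Im.
  by apply/funext => h; rewrite ImZ ImD ImN [h *: 1]mulr1.
apply: DeriveDef; last exact: cvg_lim H.
by apply/cvg_ex; eexists; exact: H.
Qed.

(** Continuity is asked only at the points of the path, since forms such as [eta] have poles
    elsewhere. *)
Definition continuous_along (a : oneform R m) : Prop :=
  forall t : R, t \in `[0, 1] -> forall j,
    {for c t, continuous (fun z => a z 0 j)}.

Lemma integrand_continuous (a : oneform R m) t : continuous_along a ->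
  t \in `[0, 1] ->
  {for t, continuous (fun u => \sum_j a (c u) 0 j * velocity c u 0 j : C)}.
Proof.
move=> ac t01; rewrite /prop_for /continuous_at.
apply: cvg_big => [|j _]; first exact: add_continuous.
apply: cvgM; last exact: C1_path_velocity_continuous.
have := @ac t t01 j; apply: continuous_comp.
exact: C1_path_continuous.
Qed.
End ChainRule.

(** * The fundamental theorem and linearity for path integrals *)

Section PathIntegral.
Variables (R : realType) (m : nat) (c : R -> 'rV[Cx R]_m).
Hypothesis c1 : C1_path c.
Local Notation C := (Cx R).
Local Notation V := 'rV[C]_m.

(** Two-sided derivatives can be demanded at 0 and 1 because a path is a curve defined on all of
    [R]. *)
Lemma FTC2_01 (f F : R -> R) :
  (forall t : R, t \in `[0, 1] -> is_derive t (1 : R) F (f t)) ->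
  (forall t : R, t \in `[0, 1] -> {for t, continuous f}) ->
  \int[lebesgue_measure]_(t in `[0, 1]) f t = F 1 - F 0.
Proof.
move=> dF cf.
have cF (t : R) : t \in `[0, 1] -> {for t, continuous F}.
  by move=> /dF[dFt _]; apply: differentiable_continuous; exact/derivable1_diffP.
have sub x : x \in `]0, 1[%R -> x \in `[(0:R), 1]%R by apply: subset_itv_oo_cc.
rewrite /Rintegral (@continuous_FTC2 _ f F 0 1) ?ltr01 //.
- by apply: continuous_in_subspaceT => t; rewrite inE; exact: cf.
- split.
  + by move=> x /sub x01; case: (dF x x01).
  + by apply: cvg_at_right_filter; apply: cF; rewrite in_itv /= lexx ler01.
  + by apply: cvg_at_left_filter; apply: cF; rewrite in_itv /= lexx ler01.
- by move=> x /sub x01; rewrite derive1E; case: (dF x x01).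
Qed.

Lemma path_integral_dform (f : V -> C) :
  (forall t : R, t \in `[0, 1] -> differentiable f (c t)) ->
  continuous_along c (dform f) ->
  path_integral c (dform f) = f (c 1) - f (c 0).
Proof.
move=> df cf; rewrite /path_integral.
have E u : \sum_j dform f (c u) 0 j * velocity c u 0 j
    = \sum_j partial j f (c u) * velocity c u 0 j.
  by apply: eq_bigr => j _; rewrite mxE.
have -> : \int[lebesgue_measure]_(t in `[0, 1])
    complex.Re (\sum_j dform f (c t) 0 j * velocity c t 0 j)
    = complex.Re (f (c 1)) - complex.Re (f (c 0)).
  apply: (FTC2_01 (F := fun u => complex.Re (f (c u)))) => t t01.
    by rewrite E; apply: is_derive_Re_path => //; exact: df.
  have H := integrand_continuous c1 cf t01.
  by apply: continuous_comp H _; exact: continuous_Re.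
have -> : \int[lebesgue_measure]_(t in `[0, 1])
    complex.Im (\sum_j dform f (c t) 0 j * velocity c t 0 j)
    = complex.Im (f (c 1)) - complex.Im (f (c 0)).
  apply: (FTC2_01 (F := fun u => complex.Im (f (c u)))) => t t01.
    by rewrite E; apply: is_derive_Im_path => //; exact: df.
  have H := integrand_continuous c1 cf t01.
  by apply: continuous_comp H _; exact: continuous_Im.
by case: (f (c 1)) (f (c 0)) => a b [].
Qed.

Lemma eq_path_integral (a b : oneform R m) :
  (forall t : R, t \in `[0, 1] -> a (c t) = b (c t)) ->
  path_integral c a = path_integral c b.
Proof.
move=> ab; rewrite /path_integral.
by congr Complex; apply: eq_Rintegral => t; rewrite inE /= => t01; rewrite ab.
Qed.

Lemma integrable_01 (f : R -> R) :
  (forall t : R, t \in `[0, 1] -> {for t, continuous f}) ->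
  lebesgue_measure.-integrable `[(0 : R), 1] (EFin \o f).
Proof.
move=> cf; apply: continuous_compact_integrable; first exact: segment_compact.
by apply: continuous_in_subspaceT => t; rewrite inE; exact: cf.
Qed.

Lemma Rintegral_01B (f g : R -> R) :
  (forall t : R, t \in `[0, 1] -> {for t, continuous f}) ->
  (forall t : R, t \in `[0, 1] -> {for t, continuous g}) ->
  \int[lebesgue_measure]_(t in `[0, 1]) (f t - g t)
  = \int[lebesgue_measure]_(t in `[0, 1]) f t
    - \int[lebesgue_measure]_(t in `[0, 1]) g t.
Proof.
move=> /integrable_01 cf /integrable_01 cg.
by apply: RintegralB.
Qed.

(** Real and imaginary parts are integrable by continuity, so each integral splits. The rules for
    zero, opposites and sums are derived from this one. *)
Lemma path_integralB (a b : oneform R m) :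
  continuous_along c a -> continuous_along c b ->
  path_integral c (fun v => a v - b v) = path_integral c a - path_integral c b.
Proof.
move=> ac bc; rewrite /path_integral.
pose fa u : C := \sum_j a (c u) 0 j * velocity c u 0 j.
pose fb u : C := \sum_j b (c u) 0 j * velocity c u 0 j.
have E u : \sum_j (a (c u) - b (c u)) 0 j * velocity c u 0 j = fa u - fb u :> C.
  by rewrite -sumrB; apply: eq_bigr => j _; rewrite !mxE mulrBl.
have Ia (t : R) : t \in `[0, 1] -> {for t, continuous fa}.
  exact: integrand_continuous.
have Ib (t : R) : t \in `[0, 1] -> {for t, continuous fb}.
  exact: integrand_continuous.
have cRe (h : R -> C) :
    (forall t : R, t \in `[0, 1] -> {for t, continuous h}) ->
    forall t : R, t \in `[0, 1] -> {for t, continuous (fun t => complex.Re (h t))}.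
  by move=> hc t /hc H; apply: continuous_comp H _; exact: continuous_Re.
have cIm (h : R -> C) :
    (forall t : R, t \in `[0, 1] -> {for t, continuous h}) ->
    forall t : R, t \in `[0, 1] -> {for t, continuous (fun t => complex.Im (h t))}.
  by move=> hc t /hc H; apply: continuous_comp H _; exact: continuous_Im.
have HRe := Rintegral_01B (cRe _ Ia) (cRe _ Ib).
have HIm := Rintegral_01B (cIm _ Ia) (cIm _ Ib).
rewrite [RHS]/GRing.add /= -HRe -HIm; congr Complex.
  by apply: eq_Rintegral => t _; rewrite E ReD ReN.
by apply: eq_Rintegral => t _; rewrite E ImD ImN.
Qed.

Lemma path_integral0 : path_integral c (fun _ => 0) = 0 :> C.
Proof.
have c0 : continuous_along c (fun _ => 0).
  by move=> t _ j; apply: cst_continuous.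
rewrite -[RHS](subrr (path_integral c (fun _ => 0))) -path_integralB //.
by apply: eq_path_integral => t _; rewrite subrr.
Qed.

Lemma path_integralN (a : oneform R m) : continuous_along c a ->
  path_integral c (fun v => - a v) = - path_integral c a.
Proof.
move=> ac; have c0 : continuous_along c (fun _ => 0).
  by move=> t _ j; apply: cst_continuous.
rewrite -sub0r -path_integral0 -path_integralB //.
by apply: eq_path_integral => t _; rewrite sub0r.
Qed.

Lemma continuous_alongN (a : oneform R m) : continuous_along c a ->
  continuous_along c (fun v => - a v).
Proof.
move=> ac t t01 j; rewrite (_ : (fun _ => _) = fun z => - a z 0 j).
  exact: (cvgN (ac t t01 j)).
by apply/funext => z; rewrite mxE.
Qed.

Lemma path_integralD (a b : oneform R m) :
  continuous_along c a -> continuous_along c b ->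
  path_integral c (fun v => a v + b v) = path_integral c a + path_integral c b.
Proof.
move=> ac bc; rewrite -[path_integral c b]opprK -(path_integralN bc).
rewrite -(path_integralB ac (continuous_alongN bc)).
by apply: eq_path_integral => t _; rewrite opprK.
Qed.

End PathIntegral.

(** * Logarithmic derivatives *)

Section LogDerivative.
Variables (K : numFieldType) (V : normedModType K).
Implicit Types (f g : V -> K) (z v : V).

(** The difference quotient is constant, equal to [f v], for [h != 0]. *)
Lemma is_derive_linear (W : normedModType K) (f : V -> W) z v :
  (forall (h : K) u w, f (h *: u + w) = h *: f u + f w) ->
  is_derive z v f (f v).
Proof.
move=> fl; have H : (fun h : K => h^-1 *: (f (h *: v + z) - f z)) @ 0^' --> f v.
  apply: (@cvg_trans _ ((fun _ : K => f v) @ 0^')); last exact: cvg_cst.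
  apply: near_eq_cvg; near=> h.
  have h0 : h != 0 by near: h; exact: nbhs_dnbhs_neq.
  by rewrite fl addrK scalerA mulVf // scale1r.
apply: DeriveDef; last exact: cvg_lim H.
by apply/cvg_ex; eexists; exact: H.
Unshelve. all: by end_near. Qed.

Lemma growth_translate (W : normedModType K) (f : V -> W) a z v :
  (fun h : K =>
     h^-1 *: (((fun y => f (y + a)) \o shift z) (h *: v) - f (z + a)))
  = (fun h : K => h^-1 *: ((f \o shift (z + a)) (h *: v) - f (z + a))).
Proof. by apply/funext => h /=; rewrite addrA. Qed.

Lemma derive_translate (W : normedModType K) (f : V -> W) a z v :
  'D_v (fun y => f (y + a)) z = 'D_v f (z + a).
Proof. by rewrite /derive growth_translate. Qed.

Lemma derivable_translate (W : normedModType K) (f : V -> W) a z v :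
  derivable f (z + a) v -> derivable (fun y => f (y + a)) z v.
Proof. by rewrite /derivable growth_translate. Qed.

Lemma dlogM f g z v : derivable f z v -> derivable g z v ->
  f z != 0 -> g z != 0 ->
  (f z * g z)^-1 * 'D_v (fun y => f y * g y) z
  = (f z)^-1 * 'D_v f z + (g z)^-1 * 'D_v g z.
Proof.
move=> df dg f0 g0; rewrite [X in _ * X = _](deriveM df dg) /GRing.scale /=.
by field; rewrite f0 g0.
Qed.

Lemma dlogV f z v : derivable f z v -> f z != 0 ->
  ((f z)^-1)^-1 * 'D_v (fun y => (f y)^-1) z = - ((f z)^-1 * 'D_v f z).
Proof.
move=> df f0; rewrite deriveV // /GRing.scale /=; field; exact: f0.
Qed.

Lemma dlogZ f (k : K) z v : derivable f z v -> k != 0 ->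
  (k * f z)^-1 * 'D_v (fun y => k * f y) z = (f z)^-1 * 'D_v f z.
Proof.
move=> df k0; rewrite [X in _ * X = _](deriveZ k df) /GRing.scale /= invfM.
by rewrite mulrACA mulVf // mul1r.
Qed.

End LogDerivative.

(** * Holomorphic functions and linear forms *)

Section ThetaAnalysis.
Variables (R : realType) (m : nat).
Local Notation C := (Cx R).
Local Notation V := 'rV[C]_m.

Lemma holomorphic_partial (f : V -> C) j z :
  holomorphic_at f z -> holomorphic_at (partial j f) z.
Proof.
apply: filterS => y Hy js.
(* [foldr] applies the last index first, so a derivative taken beforehand is appended at the end of
   the list. *)
by have := Hy (rcons js j); rewrite foldr_rcons.
Qed.

Lemma holomorphic_differentiable (f : V -> C) z :
  holomorphic_at f z -> differentiable f z.
Proof. by move=> /nbhs_singleton /(_ [::]). Qed.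

Lemma path_integral_exact (c : R -> V) (f : V -> C) : C1_path c ->
  (forall t : R, t \in `[0, 1] -> holomorphic_at f (c t)) ->
  path_integral c (dform f) = f (c 1) - f (c 0).
Proof.
move=> c1 fc; apply: path_integral_dform => // t t01 => [|j].
  exact/holomorphic_differentiable/fc.
rewrite [X in {for _, continuous X}](_ : _ = partial j f).
  apply: differentiable_continuous.
  exact/holomorphic_differentiable/holomorphic_partial/fc.
by apply/funext => z; rewrite mxE.
Qed.

Lemma differentiable_form (a : 'I_m -> C) z :
  differentiable (fun y : V => \sum_j a j * y 0 j) z.
Proof.
rewrite (_ : (fun _ => _) = \sum_j (fun y : V => a j * y 0 j)).
  apply: differentiable_sum => j; apply: differentiableZ.
  exact: differentiable_coord.
by apply/funext => y; rewrite fct_sumE.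
Qed.

Lemma derive_form (a : 'I_m -> C) z v :
  'D_v (fun y : V => \sum_j a j * y 0 j) z = \sum_j a j * v 0 j.
Proof.
have H : is_derive z v (fun y : V => \sum_j a j * y 0 j) (\sum_j a j * v 0 j).
  apply: is_derive_linear => h u w; rewrite scaler_sumr -big_split /=.
  by apply: eq_bigr => j _; rewrite !mxE mulrDr /GRing.scale /= mulrCA.
exact: derive_val.
Qed.

End ThetaAnalysis.

(** * The functions h_j *)

(** This transfers continuity to the partial derivatives of [hlog] from their explicit formula,
    which is established only where [theta] does not vanish. *)
Lemma near_continuous (T U : topologicalType) (f h : T -> U) x :
  (\forall y \near x, f y = h y) ->
  {for x, continuous f} -> {for x, continuous h}.
Proof.
rewrite /prop_for /continuous_at => fh; rewrite (nbhs_singleton fh) => cf.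
apply: cvg_trans cf; exact: near_eq_cvg.
Qed.

(** Here [t], [p], [q], [r] stand for [theta], a second partial derivative of it and two first ones,
    as in [partial_hlogE]. *)
Lemma hlog_formula_cvg (K : numFieldType) (T : Type) (F : set_system T)
    {FF : Filter F} (t p q r : T -> K) (t0 p0 q0 r0 : K) : t0 != 0 ->
  t @ F --> t0 -> p @ F --> p0 -> q @ F --> q0 -> r @ F --> r0 ->
  (fun z => (t z)^-1 * p z - (t z)^-2 * q z * r z) @ F
    --> t0^-1 * p0 - t0^-2 * q0 * r0.
Proof.
move=> t0n ct cp cq cr; apply: cvgB; first by apply: cvgM => //; exact: cvgV.
apply: cvgM => //; apply: cvgM => //.
apply: cvgV; first by rewrite expf_neq0.
by apply: cvgM.
Qed.

Section Torus.
Variables (R : realType) (g : nat) (A : polarized_torus R g).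
Local Notation C := (Cx R).
Local Notation V := 'rV[C]_g.

Lemma hlogE j z : hlog A j z = (theta A z)^-1 * partial j (theta A) z.
Proof. by rewrite /hlog /dlog !mxE. Qed.

Lemma hlog0 j : hlog A j 0 = 0.
Proof. by rewrite /hlog dtheta0 mxE. Qed.

Lemma theta_differentiable z : differentiable (theta A) z.
Proof. exact/holomorphic_differentiable/theta_entire. Qed.

Lemma partial_theta_differentiable j z : differentiable (partial j (theta A)) z.
Proof. exact/holomorphic_differentiable/holomorphic_partial/theta_entire. Qed.

Lemma partial2_theta_differentiable j k z :
  differentiable (partial k (partial j (theta A))) z.
Proof.
apply/holomorphic_differentiable/holomorphic_partial/holomorphic_partial.
exact: theta_entire.
Qed.

Lemma theta_neq0_near z : theta A z != 0 -> \forall y \near z, theta A y != 0.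
Proof.
move=> z0; have ct := differentiable_continuous (theta_differentiable z).
apply: (ct [set x | x != 0]); apply/nbhs_normP.
exists `|theta A z| => [|x /=]; first by rewrite /= normr_gt0.
by move=> H; apply/eqP => x0; move: H; rewrite x0 subr0 ltxx.
Qed.

Lemma hlog_differentiable j z : theta A z != 0 -> differentiable (hlog A j) z.
Proof.
move=> z0.
rewrite (_ : hlog A j = (fun y => (theta A y)^-1) * partial j (theta A)).
  apply: differentiableM; last exact: partial_theta_differentiable.
  by apply: differentiableV => //; exact: theta_differentiable.
by apply/funext => y; rewrite hlogE.
Qed.

Lemma partial_hlogE k j z : theta A z != 0 -> partial k (hlog A j) z
  = (theta A z)^-1 * partial k (partial j (theta A)) z
    - (theta A z)^-2 * partial k (theta A) z * partial j (theta A) z.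
Proof.
move=> z0; rewrite /partial.
rewrite (_ : hlog A j = (fun y => (theta A y)^-1) * partial j (theta A));
  last first.
  by apply/funext => y; rewrite hlogE.
have dt := @diff_derivable _ _ _ _ z (delta_mx 0 k) (theta_differentiable z).
rewrite deriveM; first last.
- by apply: diff_derivable; exact: partial_theta_differentiable.
- exact: derivableV.
rewrite deriveV //.
have alg (a b d e : C) :
  a^-1 * d + b * (- a ^- 2 * e) = a^-1 * d - a ^- 2 * e * b by ring.
exact: alg.
Qed.

Lemma partial_hlog_continuous k j z : theta A z != 0 ->
  {for z, continuous (partial k (hlog A j))}.
Proof.
move=> z0; pose G (z : V) := (theta A z)^-1 * partial k (partial j (theta A)) z
    - (theta A z)^-2 * partial k (theta A) z * partial j (theta A) z.
apply: (@near_continuous _ _ G).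
  by near=> y; rewrite partial_hlogE //; near: y; exact: theta_neq0_near.
have ct := differentiable_continuous (theta_differentiable z).
have cp i := differentiable_continuous (partial_theta_differentiable i z).
have cpp := differentiable_continuous (partial2_theta_differentiable j k z).
exact: (hlog_formula_cvg z0 ct cpp (cp k) (cp j)).
Unshelve. all: by end_near. Qed.

End Torus.

Section Torus.
Variables (R : realType) (g : nat) (A : polarized_torus R g).
Local Notation C := (Cx R).
Local Notation V := 'rV[C]_g.

Lemma continuous_along_dform (m : nat) (c : R -> 'rV[C]_m) (f : 'rV[C]_m -> C) :
  (forall t : R, t \in `[0, 1] -> forall j, {for c t, continuous (partial j f)}) ->
  continuous_along c (dform f).
Proof.
move=> H t t01 j; rewrite [X in {for _, continuous X}](_ : _ = partial j f).
  exact: H.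
by apply/funext => z; rewrite mxE.
Qed.

Lemma continuous_along_eta (c : R -> V) j :
  (forall t : R, t \in `[0, 1] -> theta A (c t) != 0) ->
  continuous_along c (Defs.eta A j).
Proof.
move=> c0; apply: continuous_along_dform => t t01 k.
exact/partial_hlog_continuous/c0.
Qed.

Lemma path_integral_eta (c : R -> V) j : C1_path c ->
  (forall t : R, t \in `[0, 1] -> theta A (c t) != 0) ->
  path_integral c (Defs.eta A j) = hlog A j (c 1) - hlog A j (c 0).
Proof.
move=> c1 c0; apply: path_integral_dform => // [t t01|].
  exact/hlog_differentiable/c0.
exact: continuous_along_eta.
Qed.

Lemma partial_coord (m : nat) (k j : 'I_m) (z : 'rV[C]_m) :
  partial k (fun y => y 0 j : C) z = (k == j)%:R.
Proof.
have H : is_derive z (delta_mx 0 k : 'rV[C]_m) (fun y : 'rV[C]_m => y 0 j : C)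
    ((delta_mx 0 k : 'rV[C]_m) 0 j).
  by apply: (@is_derive_linear C 'rV[C]_m C) => h u w; rewrite !mxE.
by rewrite /partial derive_val mxE eqxx eq_sym.
Qed.

Lemma path_integral_coord (m : nat) (c : R -> 'rV[C]_m) j : C1_path c ->
  path_integral c (dform (fun y => y 0 j)) = c 1 0 j - c 0 0 j.
Proof.
move=> c1; apply: path_integral_dform => // [t t01|].
  exact: differentiable_coord.
apply: continuous_along_dform => t t01 k.
rewrite (_ : partial k _ = fun _ => (k == j)%:R); first exact: cst_continuous.
by apply/funext => y; rewrite partial_coord.
Qed.

Lemma herm_form y l : herm A y l = \sum_j herm A (delta_mx 0 j) l * y 0 j.
Proof.
rewrite {1}(row_sum_delta y) linear_sumlz; apply: eq_bigr => j _.
by rewrite linearZl_LR /= mulrC.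
Qed.

(** This is the logarithmic derivative of the functional equation of [theta]: the exponent is affine
    in [y], so the factor contributes the constant coefficient of its linear part. *)
Lemma hlog_quasi_period j z l : theta A z != 0 -> lattice A l ->
  hlog A j (z + l) = hlog A j z + pi%:C * herm A (delta_mx 0 j) l.
Proof.
move=> z0 Ll; rewrite !hlogE /partial -derive_translate.
pose L (y : V) : C := (\sum_j (pi%:C * herm A (delta_mx 0 j) l) * y 0 j)
   + (pi / 2)%:C * herm A l l.
pose E (y : V) : C := chi A l * cexp (L y).
have LE y : pi%:C * herm A y l + (pi / 2)%:C * herm A l l = L y.
  by rewrite /L herm_form mulr_sumr; under eq_bigr do rewrite mulrA.
have tE y : theta A (y + l) = E y * theta A y by rewrite theta_period // LE.
have dL : differentiable L z.
  apply: differentiableD; first exact: differentiable_form.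
  exact: differentiable_cst.
have DL v : 'D_v L z = \sum_j (pi%:C * herm A (delta_mx 0 j) l) * v 0 j.
  rewrite /L deriveD; first by rewrite derive_form derive_cst addr0.
    by apply: diff_derivable; exact: differentiable_form.
  exact: derivable_cst.
(* A value of the semi-character has norm 1, so it can be divided out. *)
have chi0 : chi A l != 0 by rewrite -normr_eq0 chi_norm // oner_eq0.
have E0 : E z != 0 by rewrite mulf_neq0 // cexp_neq0.
have dE : differentiable E z.
  by apply: differentiableZ; exact: differentiable_cexp.
rewrite (_ : (fun y => theta A (y + l)) = fun y => E y * theta A y); last first.
  by apply/funext => y.
rewrite tE dlogM //; first last.
- by apply: diff_derivable; exact: theta_differentiable.
- exact: diff_derivable.
suff -> : (E z)^-1 * 'D_(delta_mx 0 j) E z = pi%:C * herm A (delta_mx 0 j) l.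
  exact: addrC.
have dc : derivable (fun y => cexp (L y)) z (delta_mx 0 j).
  by apply: diff_derivable; exact: differentiable_cexp.
rewrite (dlogZ dc chi0).
rewrite derive_cexp; last exact: dL.
rewrite mulKf; last exact: cexp_neq0.
rewrite DL (bigD1 j) //= mxE !eqxx mulr1.
by rewrite big1 ?addr0 // => i ij; rewrite mxE (negPf ij) andbF mulr0.
Qed.

(** The logarithmic derivative turns the factors [theta (y + q)], [1 / theta y] and the exponential
    into the three terms; the constant [1 / theta q] disappears. *)
Lemma xiE q z : theta A z != 0 -> theta A q != 0 -> theta A (z + q) != 0 ->
  xi A q z = \row_j (hlog A j (z + q) - hlog A j z - hlog A j q).
Proof.
move=> z0 q0 zq0; apply/rowP => j; rewrite !mxE.
pose L (y : V) : C := \sum_j (- hlog A j q) * y 0 j.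
have LE (y : V) : - (\sum_j hlog A j q * y 0 j) = L y.
  by rewrite -sumrN; apply: eq_bigr => i _; rewrite mulNr.
have dL : differentiable L z by exact: differentiable_form.
have dt y : differentiable (theta A) y := theta_differentiable A y.
pose T (y : V) : C := theta A (y + q).
pose N (y : V) : C := (theta A q)^-1 * (theta A y)^-1.
have FE : Ftheta A q = fun y => T y * (N y * cexp (L y)).
  by apply/funext => y; rewrite /Ftheta LE invfM mulrA /N [X in _ * X * _]mulrC.
set v := delta_mx 0 j : V.
have dtv (y : V) : derivable (theta A) y v := @diff_derivable _ _ _ _ y v (dt y).
have dT : derivable T z v := derivable_translate (dtv (z + q)).
have dV : derivable (fun y => (theta A y)^-1) z v :=
  @derivableV _ _ (theta A) z v z0 (dtv z).
have dN : derivable N z v := @derivableZ _ _ _ _ (theta A q)^-1 z v dV.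
have dc : derivable (fun y => cexp (L y)) z v.
  exact: (@diff_derivable _ _ _ _ z v (differentiable_cexp dL)).
have c0 := cexp_neq0 (L z).
have N0 : N z != 0 by rewrite mulf_neq0 ?invr_eq0.
have Nc0 : N z * cexp (L z) != 0 by rewrite mulf_neq0.
rewrite FE /partial -/v (dlogM dT (derivableM dN dc) zq0 Nc0).
rewrite (dlogM dN dc N0 c0).
have q0' : (theta A q)^-1 != 0 by rewrite invr_eq0.
rewrite /N (dlogZ dV q0') (dlogV (dtv z) z0).
rewrite (derive_cexp v dL) (mulKf c0) derive_form (bigD1 j) //= mxE !eqxx mulr1.
rewrite big1 ?addr0; last by move=> i ij; rewrite mxE (negPf ij) andbF mulr0.
rewrite /T derive_translate !hlogE -/v; exact: addrA.
Qed.

End Torus.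

(** * Forms on the Lie algebra of the extension *)

Section FTheta.
Variables (R : realType) (g : nat) (A : polarized_torus R g).
Local Notation C := (Cx R).
Local Notation V := 'rV[C]_g.

Lemma Ftheta_neq0 q z :
  theta A z != 0 -> theta A q != 0 -> theta A (z + q) != 0 ->
  Ftheta A q z != 0.
Proof.
move=> z0 q0 zq0; apply: mulf_neq0; last exact: cexp_neq0.
by apply: mulf_neq0 => //; rewrite invr_eq0 mulf_neq0.
Qed.

Lemma Ftheta_differentiable q z : theta A z != 0 -> theta A q != 0 ->
  differentiable (Ftheta A q) z.
Proof.
move=> z0 q0.
pose L (y : V) : C := \sum_j (- hlog A j q) * y 0 j.
have LE (y : V) : - (\sum_j hlog A j q * y 0 j) = L y.
  by rewrite -sumrN; apply: eq_bigr => i _; rewrite mulNr.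
have dL : differentiable L z := differentiable_form _ z.
have FE : Ftheta A q = (fun y => theta A (y + q))
     * (fun y => (theta A y * theta A q)^-1)
     * (fun y => cexp (L y)).
  by apply/funext => y; rewrite /Ftheta LE.
have dt y : differentiable (theta A) y := theta_differentiable A y.
have dq : differentiable (fun y : V => y + q) z.
  exact: (@differentiableD _ _ _ (fun y : V => y) (fun _ => q)).
have dT : differentiable (fun y => theta A (y + q)) z.
  exact: (@differentiable_comp _ _ _ _ (fun y : V => y + q) (theta A) _ dq (dt _)).
have dN : differentiable (fun y => theta A y * theta A q) z.
  exact: (differentiableM (dt z) (differentiable_cst (theta A q) z)).
have N0 : theta A z * theta A q != 0 by rewrite mulf_neq0.
rewrite FE.
apply: differentiableM (differentiable_cexp dL).
exact: differentiableM dT (differentiableV dN N0).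
Qed.

End FTheta.

Section LieG.
Variables (R : realType) (g s : nat).
Local Notation C := (Cx R).
Local Notation V := 'rV[C]_g.
Local Notation LieG := 'rV[C]_(g + s).

Lemma zpartE (v : LieG) j : zpart v 0 j = v 0 (lshift s j).
Proof. by rewrite mxE. Qed.

Lemma tpartE (v : LieG) k : tpart v k = v 0 (rshift g k).
Proof. by rewrite /tpart mxE. Qed.

Lemma zpart_lin (h : C) (u w : LieG) :
  zpart (h *: u + w) = h *: zpart u + zpart w.
Proof. by apply/rowP => j; rewrite !mxE. Qed.

Lemma growth_zpart (f : V -> C) (v w : LieG) :
  (fun h : C =>
     h^-1 *: (((fun y => f (zpart y)) \o shift v) (h *: w) - f (zpart v)))
  = (fun h : C =>
     h^-1 *: ((f \o shift (zpart v)) (h *: zpart w) - f (zpart v))).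
Proof. by apply/funext => h /=; rewrite zpart_lin. Qed.

Lemma derive_zpart (f : V -> C) (v w : LieG) :
  'D_w (fun y => f (zpart y)) v = 'D_(zpart w) f (zpart v).
Proof. by rewrite /derive growth_zpart. Qed.

Lemma derivable_zpart (f : V -> C) (v w : LieG) :
  derivable f (zpart v) (zpart w) -> derivable (fun y => f (zpart y)) v w.
Proof. by rewrite /derivable growth_zpart. Qed.

Lemma zpart_delta_l j : zpart (delta_mx 0 (lshift s j) : LieG) = delta_mx 0 j.
Proof. by apply/rowP => i; rewrite !mxE eq_lshift. Qed.

Lemma zpart_delta_r k : zpart (delta_mx 0 (rshift g k) : LieG) = 0.
Proof. by apply/rowP => i; rewrite !mxE eq_lrshift andbF. Qed.

(** A function of [zpart] is constant along the torus directions, which gives the zero block of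
    [pull]. *)
Lemma dlog_zpart (f : V -> C) (v : LieG) :
  dlog (fun y => f (zpart y)) v = pull (dlog f) v.
Proof.
apply/rowP => j; rewrite /pull !mxE /partial derive_zpart.
case: (fintype.splitP j) => i ij.
  have -> : j = lshift s i by exact: val_inj.
  by rewrite !mxE zpart_delta_l.
have -> : j = rshift g i by exact: val_inj.
by rewrite zpart_delta_r derive0 mulr0 mxE.
Qed.

Lemma zpart_continuous : continuous (@zpart R g s).
Proof.
move=> v; apply: (@cvg_mx _ _ _ _ (nbhs v)) => i j; rewrite (ord1 i) zpartE.
rewrite (_ : (fun _ => _) = fun y : LieG => y 0 (lshift s j)).
  exact: coord_continuous.
by apply/funext => y; rewrite zpartE.
Qed.

Variable c : R -> LieG.

Lemma C1_path_zpart : C1_path c -> C1_path (fun t => zpart (c t)).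
Proof.
move=> c1 j; have := c1 (lshift s j).
rewrite (_ : (fun t => complex.Re (zpart (c t) 0 j))
    = fun t => complex.Re (c t 0 (lshift s j))).
  rewrite (_ : (fun t => complex.Im (zpart (c t) 0 j))
      = fun t => complex.Im (c t 0 (lshift s j))) //.
  by apply/funext => t; rewrite zpartE.
by apply/funext => t; rewrite zpartE.
Qed.

Lemma velocity_zpart t j :
  velocity (fun u => zpart (c u)) t 0 j = velocity c t 0 (lshift s j).
Proof.
rewrite !mxE; congr (derive1 _ _ +i* derive1 _ _);
  by apply/funext => u; rewrite zpartE.
Qed.

(** The torus coordinates carry zero coefficients, so integrals of forms coming from the abelian
    variety can be computed on [C^g]. *)
Lemma path_integral_pull (a : oneform R g) :
  path_integral c (pull a) = path_integral (fun t => zpart (c t)) a.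
Proof.
rewrite /path_integral.
have E t : \sum_j pull a (c t) 0 j * velocity c t 0 j
    = \sum_j a (zpart (c t)) 0 j * velocity (fun u => zpart (c u)) t 0 j.
  rewrite big_split_ord /= [X in _ + X]big1 ?addr0.
    by apply: eq_bigr => j _; rewrite velocity_zpart /pull row_mxEl.
  by move=> k _; rewrite /pull row_mxEr mxE mul0r.
by congr Complex; apply: eq_Rintegral => t _; rewrite E.
Qed.

Lemma continuous_along_pull (a : oneform R g) :
  continuous_along (fun t => zpart (c t)) a -> continuous_along c (pull a).
Proof.
move=> ac t t01 j; rewrite -(splitK j); case: (fintype.split j) => k /=.
  rewrite (_ : (fun _ => _) = fun z : LieG => a (zpart z) 0 k); last first.
    by apply/funext => z; rewrite /pull row_mxEl.
  apply: (@continuous_comp _ _ _ (@zpart R g s) (fun z => a z 0 k)).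
    exact: zpart_continuous.
  exact: ac.
rewrite (_ : (fun _ => _) = fun z : LieG => 0); first exact: cst_continuous.
by apply/funext => z; rewrite /pull row_mxEr mxE.
Qed.

End LieG.

Lemma cvgB_cst (K : numFieldType) (T : Type) (F : set_system T) {FF : Filter F}
    (u v : T -> K) (a b k : K) :
  u @ F --> a -> v @ F --> b -> (fun z => u z - v z - k) @ F --> a - b - k.
Proof. by move=> ua vb; apply: cvgB; [exact: cvgB | exact: cvg_cst]. Qed.

(** * Forms of the third kind on the extension, and the integrals entering the period matrices *)

Section Extension.
Variables (R : realType) (g : nat) (A : polarized_torus R g) (n s : nat).
Variable M : one_motive A n s.
Local Notation C := (Cx R).
Local Notation V := 'rV[C]_g.
Local Notation LieG := 'rV[C]_(g + s).

(** [Zcoord] is the product of [e^{t_k}] and [F_{q_k}(z)], both nonzero at generic points. *)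
Lemma xi_tildeE k v : generic M v ->
  xi_tilde M k v
  = dform (fun w => w 0 (rshift g k)) v + pull (xi A (qlog M k)) v.
Proof.
move=> [z0 zq0].
have q0 := theta_qlog M k; have F0 := Ftheta_neq0 z0 q0 (zq0 k).
pose L (w : LieG) : C := w 0 (rshift g k).
have dL : differentiable L v by exact: differentiable_coord.
have c0 := cexp_neq0 (L v).
have dF := Ftheta_differentiable z0 q0.
have ZE : Zcoord M k = fun w => cexp (L w) * Ftheta A (qlog M k) (zpart w).
  by apply/funext => w; rewrite /Zcoord tpartE.
apply/rowP => j; rewrite /xi_tilde /xi -dlog_zpart ZE !mxE.
have dc : derivable (fun w => cexp (L w)) v (delta_mx 0 j).
  exact: (@diff_derivable _ _ _ _ v _ (differentiable_cexp dL)).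
have dFz :
    derivable (fun w : LieG => Ftheta A (qlog M k) (zpart w)) v (delta_mx 0 j).
  apply: derivable_zpart; exact: (@diff_derivable _ _ _ _ (zpart v) _ dF).
rewrite /partial (dlogM dc dFz c0 F0) (derive_cexp _ dL) (mulKf c0) //.
Qed.

(* [xi A q] where it is regular (see [xiE]), written without division by
   [Ftheta], so that its continuity is visible. *)
Definition xi_log_form (q : V) : oneform R g :=
  fun z => \row_j (hlog A j (z + q) - hlog A j z - hlog A j q).

Lemma continuous_along_xi_log (c : R -> V) q :
  (forall t : R, t \in `[0, 1] -> theta A (c t) != 0) ->
  (forall t : R, t \in `[0, 1] -> theta A (c t + q) != 0) ->
  continuous_along c (xi_log_form q).
Proof.
move=> c0 cq0 t t01 j.
rewrite (_ : (fun _ => _) = fun z : V =>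
    hlog A j (z + q) - hlog A j z - hlog A j q); last first.
  by apply/funext => z; rewrite mxE.
have ch := differentiable_continuous (hlog_differentiable j (c0 t t01)).
have chq := differentiable_continuous (hlog_differentiable j (cq0 t t01)).
have ca : {for c t, continuous (fun z : V => z + q)}.
  by apply: (@cvgD _ _ _ (nbhs (c t))); [exact: cvg_id | exact: cvg_cst].
have cc : {for c t, continuous (fun z : V => hlog A j (z + q))}.
  exact: (continuous_comp (f := fun z : V => z + q)).
exact: (cvgB_cst cc ch).
Qed.

Section Path.
Variable c : R -> LieG.
Hypothesis c1 : C1_path c.
Hypothesis cg : forall t : R, t \in `[0, 1] -> generic M (c t).

Lemma pull_xi_log k t : t \in `[0, 1] ->
  pull (xi A (qlog M k)) (c t) = pull (xi_log_form (qlog M k)) (c t).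
Proof. by move=> /cg [z0 zq0]; rewrite /pull xiE // theta_qlog. Qed.

Lemma continuous_along_dt k :
  continuous_along c (dform (fun w => w 0 (rshift g k))).
Proof.
apply: continuous_along_dform => t t01 j.
rewrite (_ : partial j _ = fun _ => (j == rshift g k)%:R).
  exact: cst_continuous.
by apply/funext => y; rewrite partial_coord.
Qed.

Lemma continuous_along_pull_xi_log k :
  continuous_along c (pull (xi_log_form (qlog M k))).
Proof.
by apply/continuous_along_pull/continuous_along_xi_log => t /cg [z0 zq0].
Qed.

(** The two terms d log F cancel at generic points, which leaves [- dt_k]. *)
Lemma path_integral_xiG k :
  path_integral c (xiG M k) = - (tpart (c 1) k - tpart (c 0) k).
Proof.
rewrite !tpartE -path_integral_coord // -path_integralN //; last first.
  exact: continuous_along_dt.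
apply: eq_path_integral => t t01.
by rewrite /xiG xi_tildeE ?opprD ?subrK //; exact: cg.
Qed.

(* The normalization [gam_xi_tilde] then turns the integral of [xiG] over a loop
   into that of d log F, which [gam_branch] gives. *)
Lemma path_integral_xi_tilde k :
  path_integral c (xi_tilde M k)
  = path_integral c (pull (xi A (qlog M k))) - path_integral c (xiG M k).
Proof.
rewrite path_integral_xiG opprK !tpartE -path_integral_coord //.
have E1 : path_integral c (pull (xi A (qlog M k)))
    = path_integral c (pull (xi_log_form (qlog M k))).
  by apply: eq_path_integral => t t01; exact: pull_xi_log.
rewrite E1 addrC.
rewrite -(path_integralD c1 (@continuous_along_dt k)
  (@continuous_along_pull_xi_log k)).
apply: eq_path_integral => t t01; rewrite xi_tildeE; last exact: cg.
by rewrite pull_xi_log.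
Qed.

End Path.

Variable D : period_data M.

Lemma zpart_gam_theta i (t : R) :
  t \in `[0, 1] -> theta A (zpart (gam D i t)) != 0.
Proof. by move=> t01; case: (gam_generic D i t01). Qed.

Lemma lam_lattice i : lattice A (lam A i).
Proof.
exists (fun k => (k == i)%:Z); rewrite (bigD1 i) //= eqxx big1 ?addr0 //.
by move=> k /negPf ->.
Qed.

Lemma in01_0 : (0 : R) \in `[0, 1]. Proof. by rewrite in_itv /= lexx ler01. Qed.
Lemma in01_1 : (1 : R) \in `[0, 1]. Proof. by rewrite in_itv /= lexx ler01. Qed.

Lemma gam_omega i j : path_integral (gam D i) (pull (omega j)) = lam A i 0 j.
Proof.
rewrite path_integral_pull path_integral_coord; last exact/C1_path_zpart/gam_C1.
by rewrite -(gam_lift D i) !mxE.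
Qed.

(** The projected path ends at its starting point plus [lam A i], and the quasi-period of [hlog]
    does not depend on that starting point. *)
Lemma gam_eta i j : path_integral (gam D i) (pull (Defs.eta A j))
  = pi%:C * herm A (delta_mx 0 j) (lam A i).
Proof.
rewrite path_integral_pull path_integral_eta; first last.
- exact: zpart_gam_theta.
- exact/C1_path_zpart/gam_C1.
have -> : zpart (gam D i 1) = zpart (gam D i 0) + lam A i.
  by rewrite -(gam_lift D i) addrC subrK.
rewrite hlog_quasi_period; last exact: lam_lattice.
  by rewrite [LHS]addrC addKr.
exact/zpart_gam_theta/in01_0.
Qed.

Lemma gam_xiG i k : path_integral (gam D i) (xiG M k)
  = pi%:C * herm A (qlog M k) (lam A i)
    - \sum_j hlog A j (qlog M k) * lam A i 0 j.
Proof.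
have := gam_xi_tilde D i k.
rewrite path_integral_xi_tilde; first last.
- by move=> t; exact: gam_generic.
- exact: gam_C1.
move/eqP; rewrite subr_eq0 => /eqP <-; rewrite gam_branch.
by congr (_ - _); apply: eq_bigr => j _; rewrite gam_omega.
Qed.

(** The end points differ by an element of the kernel of the exponential, under which [fex] is
    invariant. *)
Lemma loop_df (c : R -> LieG) l : C1_path c -> exp_kernel M (c 1 - c 0) ->
  (forall t : R, t \in `[0, 1] -> holomorphic_at (fex D l) (c t)) ->
  path_integral c (dform (fex D l)) = 0.
Proof.
move=> c1 ck fc; rewrite path_integral_exact //.
have E : c 0 + (c 1 - c 0) = c 1 by rewrite addrC subrK.
by rewrite -(fex_periodic D l (c 0) ck) E subrr.
Qed.

Lemma gam_df i l : path_integral (gam D i) (dform (fex D l)) = 0.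
Proof.
by apply: loop_df; [exact: gam_C1|exact: gam_loop|move=> t; exact: fex_gam].
Qed.

Lemma del_df k l : path_integral (del D k) (dform (fex D l)) = 0.
Proof.
by apply: loop_df; [exact: del_C1|exact: del_loop|move=> t; exact: fex_del].
Qed.

Lemma del_omega k j : path_integral (del D k) (pull (omega j)) = 0.
Proof.
rewrite path_integral_pull path_integral_coord; last exact/C1_path_zpart/del_C1.
by rewrite !del_torus ?in01_0 ?in01_1 // subrr.
Qed.

(** The path stays above [z = 0], where [theta] is 1, so [eta] has no pole on it. *)
Lemma del_eta k j : path_integral (del D k) (pull (Defs.eta A j)) = 0.
Proof.
rewrite path_integral_pull path_integral_eta; first last.
- by move=> t t01; rewrite del_torus // theta0 oner_eq0.
- exact/C1_path_zpart/del_C1.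
by rewrite !del_torus ?in01_0 ?in01_1 // subrr.
Qed.

Lemma opn_omega i j : path_integral (opn D i) (pull (omega j)) = plog M i 0 j.
Proof.
rewrite path_integral_pull path_integral_coord; last exact/C1_path_zpart/opn_C1.
by rewrite opn_endz opn_start !mxE subr0.
Qed.

(** The normalization [dtheta0] removes the contribution of the origin. *)
Lemma opn_eta i j :
  path_integral (opn D i) (pull (Defs.eta A j)) = hlog A j (plog M i).
Proof.
rewrite path_integral_pull path_integral_eta; first last.
- by move=> t t01; case: (opn_generic D i t01).
- exact/C1_path_zpart/opn_C1.
rewrite opn_endz opn_start (_ : zpart 0 = 0) ?hlog0 ?subr0 //.
by apply/rowP => k; rewrite !mxE.
Qed.

(** The torus coordinates run from 0 to [ell - logF], and [xiG] is [- dt_k]. *)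
Lemma opn_xiG i k : path_integral (opn D i) (xiG M k) = logF D i k - ell D i k.
Proof.
rewrite path_integral_xiG; [|exact: opn_C1|by move=> t; exact: opn_generic].
by rewrite opn_start opn_endt tpartE mxE subr0 opprB.
Qed.

Lemma opn_df i l : path_integral (opn D i) (dform (fex D l)) = (i == l)%:R.
Proof.
rewrite path_integral_exact; [|exact: opn_C1|by move=> t; exact: fex_opn].
by rewrite opn_start fex_dual eq_sym.
Qed.

End Extension.

(** * Block triangular matrices *)

Section BlockSwap.
Variables n m s : nat.

(* The columns (xi, omega eta, df), in this order, are brought to the order
   (df, omega eta, xi), which makes the period matrices block triangular. *)
Definition swap_blocks (j : 'I_(n + m + s)) : 'I_(s + m + n) :=
  match fintype.split j with
  | inl j' => match fintype.split j' with
              | inl a => rshift (s + m) a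
              | inr b => lshift n (rshift s b)
              end
  | inr k => lshift n (lshift m k)
  end.

End BlockSwap.

Lemma split_lshiftE a b (i : 'I_a) : fintype.split (lshift b i) = inl i.
Proof. exact: (unsplitK (inl i)). Qed.

Lemma split_rshiftE a b (i : 'I_b) : fintype.split (rshift a i) = inr i.
Proof. exact: (unsplitK (inr i)). Qed.

Lemma swap_blocksK n m s : cancel (@swap_blocks n m s) (@swap_blocks s m n).
Proof.
move=> j; have splitE := (split_lshiftE, split_rshiftE).
case: (split_ordP j) => [j' ->|k ->]; last by rewrite /swap_blocks !splitE.
by case: (split_ordP j') => i ->; rewrite /swap_blocks !splitE.
Qed.

Section BlockPerm.
Variables n m s : nat.

Lemma block_perm_inj :
  injective (fun j : 'I_(n + m + s) =>
    cast_ord (block_swap n m s) (swap_blocks j)).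
Proof. by move=> i j /cast_ord_inj /(can_inj (@swap_blocksK n m s)). Qed.

(** The cast brings [swap_blocks] back to one index type, so that the same permutation acts on the
    columns of both period matrices. *)
Definition block_perm : 'S_(n + m + s) := perm block_perm_inj.

Lemma cast_block_perm j :
  cast_ord (esym (block_swap n m s)) (block_perm j) = swap_blocks j.
Proof. by rewrite permE cast_ordK. Qed.

End BlockPerm.

(** The permutation matrix meets its inverse in the middle of the product. *)
Lemma mul_col_perm_tr (K : comPzRingType) n (p : 'S_n) (A B : 'M[K]_n) :
  col_perm p A *m (col_perm p B)^T = A *m B^T.
Proof.
rewrite !col_permE trmx_mul tr_perm_mx invgK mulmxA -(mulmxA A) -perm_mxM.
by rewrite mulVg perm_mx1 mulmx1.
Qed.

Section DualBlocks.
Variables (K : fieldType) (n m s : nat) (t : K).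
Variables (L : 'M[K]_(n, m)) (P P' : 'M[K]_m).
Variables (Xi : 'M[K]_(n, s)) (U : 'M[K]_(m, s)).
Variables (U' : 'M[K]_(m, n)) (L' : 'M[K]_(s, m)) (Xi' : 'M[K]_(s, n)).

(** Rows are open paths, loops [gam], loops [del]; columns are [df], then omega and eta, then [xiG].
    In [lower_blocks] the rows are the dual chains and the columns follow the dual forms. *)
Definition upper_blocks : 'M[K]_(n + m + s) :=
  block_mx (block_mx 1%:M L 0 P) (col_mx Xi U) 0 t%:M.
Definition lower_blocks : 'M[K]_(n + m + s) :=
  block_mx (block_mx t%:M 0 U' P') 0 (row_mx Xi' L') 1%:M.

(** The transposed second factor is also block upper triangular, hence so is the product. The
    hypotheses are the central diagonal block and the three blocks above the diagonal, the first of
    them transposed. *)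
Lemma mul_dual_blocks :
  U' + P' *m L^T = 0 -> P *m P'^T = t%:M ->
  Xi + L *m L'^T + Xi'^T = 0 -> U + P *m L'^T = 0 ->
  upper_blocks *m lower_blocks^T = t%:M.
Proof.
move=> H1 H2 H3 H4; rewrite /upper_blocks /lower_blocks.
rewrite !tr_block_mx !tr_row_mx !trmx0 !trmx1 !tr_scalar_mx.
rewrite mulmx_block !mulmx0 !mul0mx !mulmx1 !add0r ?addr0.
rewrite mulmx_block mul_block_col !mulmx0 !mul0mx !mul1mx !addr0 !add0r.
rewrite add_col_mx H2.
have -> : U'^T + L *m P'^T = 0.
  by rewrite -[L]trmxK -trmx_mul -linearD /= H1 trmx0.
rewrite [X in col_mx X _]addrC [Xi'^T + _]addrC addrA H3.
by rewrite [P *m _ + _]addrC H4 col_mx0 -!scalar_mx_block.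
Qed.

End DualBlocks.

Lemma det_upper_blocks (K : fieldType) n m s (t : K) L P (Xi : 'M[K]_(n, s)) U :
  \det (@upper_blocks K n m s t L P Xi U) = \det P * t ^+ s.
Proof. by rewrite !det_ublock det1 mul1r det_scalar. Qed.

Lemma det_col_perm (K : comPzRingType) n (p : 'S_n) (A : 'M[K]_n) :
  \det (col_perm p A) = (-1) ^+ p * \det A.
Proof. by rewrite col_permE det_mulmx det_perm odd_permV mulrC. Qed.

Lemma Jmx_mul_tr (K : pzRingType) g :
  let J := block_mx 0 1%:M (- 1%:M) 0 : 'M[K]_(g + g) in J *m J^T = 1%:M.
Proof.
rewrite /= tr_block_mx !trmx0 linearN /= trmx1 mulmx_block.
rewrite !mulmx0 !mul0mx !mulNmx !mulmxN !mulmx1 ?opprK ?oppr0 !addr0 !add0r.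
by rewrite -scalar_mx_block.
Qed.

(** With [W] and [N] the periods of omega and eta, this is the relation between the period matrix of
    the dual torus and [J] times that of the torus times [J^T]. *)
Lemma Jmx_row_mx (K : comNzRingType) g (N W : 'M[K]_(g + g, g)) :
  let J := block_mx 0 1%:M (- 1%:M) 0 : 'M[K]_(g + g) in
  J *m row_mx N (- W) = J *m row_mx W N *m J^T.
Proof.
rewrite /= -mulmxA; congr (_ *m _).
rewrite tr_block_mx !trmx0 linearN /= trmx1 mul_row_block.
by rewrite !mulmx0 !mulmx1 add0r addr0 mulmxN mulmx1.
Qed.

(** [t^-1 *: B^T] is a right inverse of the square matrix [A], hence its inverse. *)
Lemma dual_of_mul (K : fieldType) N (t : K) (A B : 'M[K]_N) : t != 0 ->
  A *m B^T = t%:M -> A \in unitmx /\ B = (t *: invmx A)^T.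
Proof.
move=> t0 AB; have AtB : A *m (t^-1 *: B^T) = 1%:M.
  by rewrite -scalemxAr AB scale_scalar_mx mulVf.
have [uA _] := mulmx1_unit AtB; split => //.
have <- : t^-1 *: B^T = invmx A by rewrite -[LHS](mulKmx uA) AtB mulmx1.
by rewrite scalerA mulfV // scale1r trmxK.
Qed.

(** This discards the signature of the column permutation. *)
Lemma sign_eq_or (K : idomainType) (x y : K) (b : bool) :
  (-1) ^+ b * x = y \/ (-1) ^+ b * x = - y -> x = y \/ x = - y.
Proof.
case: b; rewrite ?expr0 ?expr1 ?mul1r ?mulN1r //.
by case=> [<-|/oppr_inj]; [right; rewrite opprK | left].
Qed.

(** * The period matrices *)

Lemma twoipi_neq0 (R : realType) : twoipi R != 0.
Proof.
apply/eqP => -[] /eqP; rewrite mulf_eq0 pnatr_eq0 /=.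
by rewrite gt_eqF // pi_gt0.
Qed.

(** Hermitian symmetry makes the difference that of a complex number and its conjugate. *)
Lemma hermB_Im (R : realType) (g : nat) (A : polarized_torus R g) u v :
  herm A u v - herm A v u = (0 +i* (2 * complex.Im (herm A u v)) : Cx R).
Proof.
rewrite (hermC (herm A) v u) /= expr0 mul1r.
case: (herm A u v) => a b; rewrite /GRing.add /= subrr; congr Complex.
by rewrite opprK mulrDl mul1r.
Qed.

(** * Periods of the torus and Legendre's relation *)

Section Blocks.
Variables (R : realType) (g : nat) (A : polarized_torus R g).
Local Notation C := (Cx R).

Definition omega_mx : 'M[C]_(g + g, g) := \matrix_(i, j) lam A i 0 j.
Definition eta_mx : 'M[C]_(g + g, g) :=
  \matrix_(i, j) (pi%:C * herm A (delta_mx 0 j) (lam A i)).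
Definition log_mx (n : nat) (p : 'I_n -> 'rV[C]_g) : 'M[C]_(n, g) :=
  \matrix_(i, j) p i 0 j.
Definition hlog_mx (n : nat) (p : 'I_n -> 'rV[C]_g) : 'M[C]_(n, g) :=
  \matrix_(i, j) hlog A j (p i).
(** The matrix form of the periods computed in [gam_xiG]. *)
Definition Upsilon (n : nat) (p : 'I_n -> 'rV[C]_g) : 'M[C]_(g + g, n) :=
  eta_mx *m (log_mx p)^T - omega_mx *m (hlog_mx p)^T.
Definition J : 'M[C]_(g + g) := block_mx 0 1%:M (- 1%:M) 0.

(** A row of [eta_mx] lists the coefficients of the linear form [pi * H(., lambda_i)], evaluated
    here at [p k]. *)
Lemma mul_eta_mx n (p : 'I_n -> 'rV[C]_g) i k :
  (eta_mx *m (log_mx p)^T) i k = pi%:C * herm A (p k) (lam A i).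
Proof.
rewrite mxE herm_form mulr_sumr; apply: eq_bigr => j _.
by rewrite !mxE mulrA.
Qed.

Lemma UpsilonE n (p : 'I_n -> 'rV[C]_g) i k :
  Upsilon p i k = pi%:C * herm A (p k) (lam A i)
    - \sum_j hlog A j (p k) * lam A i 0 j.
Proof.
rewrite mxE mul_eta_mx; congr (_ + _); rewrite !mxE; congr (- _).
by apply: eq_bigr => j _; rewrite !mxE mulrC.
Qed.

Lemma legendre_relation :
  row_mx omega_mx eta_mx *m (J *m row_mx eta_mx (- omega_mx))^T = (twoipi R)%:M.
Proof.
rewrite trmx_mul mulmxA tr_row_mx linearN /= mul_row_col mulmxN.
(* The product is this antisymmetric matrix times [J^T]. Its entries are [pi] times differences of
   [herm] with exchanged arguments, given by [hermB_Im] and the symplectic basis. *)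
have -> : omega_mx *m eta_mx^T - eta_mx *m omega_mx^T = twoipi R *: J.
  apply/matrixP => i k.
  (* [omega_mx] is [log_mx (lam A)] *)
  have E : (eta_mx *m omega_mx^T) i k = pi%:C * herm A (lam A k) (lam A i).
    exact: (mul_eta_mx (lam A)).
  have E' : (omega_mx *m eta_mx^T) i k = pi%:C * herm A (lam A i) (lam A k).
    have <- : (omega_mx *m eta_mx^T)^T k i = (omega_mx *m eta_mx^T) i k.
      by rewrite [LHS]mxE.
    by rewrite trmx_mul trmxK; exact: (mul_eta_mx (lam A)).
  rewrite [LHS]mxE [X in _ + X]mxE E E' -mulrBr hermB_Im lam_symplectic.
  rewrite [RHS]mxE.
  have -> : J i k = (Jmx R g i k)%:C.
    rewrite -(splitK i) -(splitK k).
    case: (fintype.split i) => i'; case: (fintype.split k) => k' /=.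
    - by rewrite /J /Jmx !block_mxEul !mxE.
    - by rewrite /J /Jmx !block_mxEur !mxE; case: (_ == _).
    - rewrite /J /Jmx !block_mxEdl !mxE.
      by case: (_ == _); rewrite ?oppr0 // rmorphN.
    - by rewrite /J /Jmx !block_mxEdr !mxE.
  by apply/eqP; rewrite eq_complex /=; apply/andP; split; apply/eqP; ring.
by rewrite -scalemxAl Jmx_mul_tr scale_scalar_mx mulr1.
Qed.

(** Determinants are taken in Legendre's relation; the second factor is [J *m P *m J^T], and the two
    factors from [J] multiply to 1. *)
Lemma det_period_sqr : let P := row_mx omega_mx eta_mx in
  \det P ^+ 2 = twoipi R ^+ (g + g).
Proof.
move=> P; have := congr1 determinant legendre_relation.
rewrite -/P Jmx_row_mx det_mulmx det_tr !det_mulmx det_scalar => <-.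
have JJ : \det J * \det J^T = 1 by rewrite -det_mulmx Jmx_mul_tr det1.
by rewrite mulrAC JJ mul1r expr2.
Qed.

Lemma mul_J_lshift (m : nat) (X : 'M[C]_(g + g, m)) a j :
  (J *m X) (lshift g a) j = X (rshift g a) j.
Proof.
by rewrite -{1}[X]vsubmxK mul_block_col col_mxEu mul0mx mul1mx add0r mxE.
Qed.

Lemma mul_J_rshift (m : nat) (X : 'M[C]_(g + g, m)) a j :
  (J *m X) (rshift g a) j = - X (lshift g a) j.
Proof.
rewrite -{1}[X]vsubmxK mul_block_col col_mxEd mul0mx mulNmx mul1mx addr0.
by rewrite !mxE.
Qed.

End Blocks.

Lemma chain_integral1 (R : realType) m (c : R -> 'rV[Cx R]_m) a :
  chain_integral (1, c) a = path_integral c a.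
Proof. by []. Qed.

Lemma chain_integralN1 (R : realType) m (c : R -> 'rV[Cx R]_m) a :
  chain_integral (- 1, c) a = - path_integral c a.
Proof. by []. Qed.

(** * Block triangular forms of the period matrices *)

Section PeriodMatrix.
Variables (R : realType) (g : nat) (A : polarized_torus R g) (n s : nat).
Local Notation C := (Cx R).

Lemma period_matrix_blocks (M : one_motive A n s) (D : period_data M) :
  col_perm (block_perm n (g + g) s) (period_matrix D)
  = upper_blocks (twoipi R)
      (row_mx (log_mx (plog M)) (hlog_mx A (plog M)))
      (row_mx (omega_mx A) (eta_mx A))
      (logF D - ell D) (Upsilon A (qlog M)).
Proof.
apply/matrixP => i j; rewrite [LHS]mxE [LHS]mxE cast_block_perm /upper_blocks.
rewrite /basis_chain /basis_form /swap_blocks.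
case: (split_ordP i) => [i' -> | k ->].
- case: (split_ordP i') => [a -> | b ->]; rewrite chain_integral1.
  + case: (split_ordP j) => [j' -> | l ->].
      rewrite block_mxEul; case: (split_ordP j') => [l -> | d ->].
        by rewrite split_rshiftE block_mxEul mxE opn_df.
      rewrite block_mxEur split_lshiftE split_rshiftE.
      case: (split_ordP d) => [e -> | e ->].
        by rewrite row_mxEl mxE opn_omega.
      by rewrite row_mxEr mxE opn_eta.
    by rewrite !split_lshiftE block_mxEur col_mxEu !mxE opn_xiG.
  + case: (split_ordP j) => [j' -> | l ->].
      rewrite block_mxEul; case: (split_ordP j') => [l -> | d ->].
        by rewrite split_rshiftE block_mxEdl mxE gam_df.
      rewrite block_mxEdr split_lshiftE split_rshiftE.
      case: (split_ordP d) => [e -> | e ->].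
        by rewrite row_mxEl mxE gam_omega.
      by rewrite row_mxEr mxE gam_eta.
    by rewrite !split_lshiftE block_mxEur col_mxEd UpsilonE gam_xiG.
- rewrite chain_integral1; case: (split_ordP j) => [j' -> | l ->].
    rewrite block_mxEdl mxE; case: (split_ordP j') => [l _ | d _].
      by rewrite split_rshiftE del_df.
    rewrite split_lshiftE split_rshiftE; case: (split_ordP d) => e _.
      exact: del_omega.
    exact: del_eta.
  by rewrite !split_lshiftE block_mxEdr mxE del_xiG; case: eqP.
Qed.

(** The middle dual chains are [- J] applied to the loops, and the middle dual forms are the
    opposites of eta and minus omega. The two signs cancel in the central block, while one remains
    in front of [Upsilon]. *)
Lemma dual_period_matrix_blocks (M : one_motive A s n) (D : period_data M) :
  col_perm (block_perm n (g + g) s) (dual_period_matrix D)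
  = lower_blocks (twoipi R)
      (J R g *m row_mx (eta_mx A) (- omega_mx A))
      (- (J R g *m Upsilon A (qlog M)))
      (row_mx (hlog_mx A (plog M)) (- log_mx (plog M)))
      (ell D - logF D).
Proof.
(* Some dual forms carry a sign inside the integral; extracting it uses continuity along the
   path. *)
have eta0 (c : R -> 'rV[C]_(g + n)) e : C1_path c ->
    (forall t : R, t \in `[0, 1] -> theta A (zpart (c t)) != 0) ->
    path_integral c (fun v => - pull (Defs.eta A e) v)
    = - path_integral c (pull (Defs.eta A e)).
  move=> c1 c0; apply: path_integralN => //.
  by apply/continuous_along_pull/continuous_along_eta.
have df0 (c : R -> 'rV[C]_(g + n)) l : C1_path c ->
    (forall t : R, t \in `[0, 1] -> holomorphic_at (fex D l) (c t)) ->
    path_integral c (fun v => - dform (fex D l) v)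
    = - path_integral c (dform (fex D l)).
  move=> c1 fc; apply: path_integralN => //.
  apply: continuous_along_dform => t t01 k; apply: differentiable_continuous.
  exact/holomorphic_differentiable/holomorphic_partial/fc.
have gam_N b e : path_integral (gam D b) (fun v => - pull (Defs.eta A e) v)
    = - (pi%:C * herm A (delta_mx 0 e) (lam A b)).
  by rewrite eta0 ?gam_eta //; [exact: gam_C1 | exact: zpart_gam_theta].
have gam_dfN b l : path_integral (gam D b) (fun v => - dform (fex D l) v) = 0.
  by rewrite df0 ?gam_df ?oppr0 //; [exact: gam_C1 | move=> t; exact: fex_gam].
have del_N a e : path_integral (del D a) (fun v => - pull (Defs.eta A e) v) = 0.
  rewrite eta0 ?del_eta ?oppr0 //; first exact: del_C1.
  by move=> t t01; rewrite del_torus // theta0 oner_eq0.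
have del_dfN a l : path_integral (del D a) (fun v => - dform (fex D l) v) = 0.
  by rewrite df0 ?del_df ?oppr0 //; [exact: del_C1 | move=> t; exact: fex_del].
have opn_N k e : path_integral (opn D k) (fun v => - pull (Defs.eta A e) v)
    = - hlog A e (plog M k).
  rewrite eta0 ?opn_eta //; first exact: opn_C1.
  by move=> t t01; case: (opn_generic D k t01).
have opn_dfN k l :
    path_integral (opn D k) (fun v => - dform (fex D l) v) = - (k == l)%:R.
  by rewrite df0 ?opn_df //; [exact: opn_C1 | move=> t; exact: fex_opn].
apply/matrixP => i j; rewrite [LHS]mxE [LHS]mxE cast_block_perm /lower_blocks.
rewrite /dual_basis_chain /dual_basis_form /swap_blocks.
case: (split_ordP i) => [i' -> | k ->].
- case: (split_ordP i') => [a -> | b ->].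
  + rewrite chain_integral1; case: (split_ordP j) => [j' -> | l ->].
      rewrite block_mxEul; case: (split_ordP j') => [l -> | d ->].
        by rewrite split_rshiftE block_mxEul mxE del_xiG; case: eqP.
      rewrite block_mxEur mxE split_lshiftE split_rshiftE.
      case: (split_ordP d) => e _.
        exact: del_N.
      exact: del_omega.
    by rewrite !split_lshiftE block_mxEur mxE del_dfN.
  + case: (split_ordP j) => [j' -> | l ->]; last first.
      rewrite block_mxEur mxE !split_lshiftE.
      case: (split_ordP b) => b' _.
        by rewrite chain_integralN1 gam_dfN oppr0.
      by rewrite chain_integral1 gam_dfN.
    rewrite block_mxEul; case: (split_ordP j') => [l -> | d ->].
      rewrite split_rshiftE block_mxEdl [RHS]mxE.
      case: (split_ordP b) => b' ->.
        by rewrite mul_J_lshift UpsilonE chain_integralN1 gam_xiG.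
      by rewrite mul_J_rshift UpsilonE chain_integral1 gam_xiG opprK.
    rewrite block_mxEdr split_lshiftE split_rshiftE.
    case: (split_ordP d) => e ->; case: (split_ordP b) => b' ->.
    * by rewrite mul_J_lshift row_mxEl mxE chain_integralN1 gam_N opprK.
    * by rewrite mul_J_rshift row_mxEl mxE chain_integral1 gam_N.
    * by rewrite mul_J_lshift row_mxEr !mxE chain_integralN1 gam_omega.
    * by rewrite mul_J_rshift row_mxEr !mxE chain_integral1 gam_omega opprK.
- rewrite chain_integralN1; case: (split_ordP j) => [j' -> | l ->].
    rewrite block_mxEdl; case: (split_ordP j') => [l -> | d ->].
      by rewrite split_rshiftE row_mxEl !mxE opn_xiG opprB.
    rewrite row_mxEr split_lshiftE split_rshiftE; case: (split_ordP d) => e ->.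
      by rewrite row_mxEl mxE opn_N opprK.
    by rewrite row_mxEr !mxE opn_omega.
  by rewrite !split_lshiftE block_mxEdr mxE opn_dfN opprK.
Qed.

End PeriodMatrix.

Theorem corollary5p8 (R : realType) (g n s : nat) (A : polarized_torus R g)
    (M : one_motive A n s) (D : period_data M)
    (D' : period_data (cartier_dual M)) (hDD' : compatible_data D D') :
  [/\ period_matrix D \in unitmx,
      dual_period_matrix D' = (twoipi R *: invmx (period_matrix D))^T,
      \det (period_matrix D) = twoipi R ^+ (g + s) \/
      \det (period_matrix D) = - twoipi R ^+ (g + s) &
      \det (dual_period_matrix D') = twoipi R ^+ (n + g) \/
      \det (dual_period_matrix D') = - twoipi R ^+ (n + g)].
Proof.
have t0 := twoipi_neq0 R; set t := twoipi R in t0 *.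
have [ell_eq logF_eq] := hDD'.
have PD : period_matrix D *m (dual_period_matrix D')^T = t%:M.
  rewrite -(mul_col_perm_tr (block_perm n (g + g) s)).
  rewrite period_matrix_blocks dual_period_matrix_blocks; apply: mul_dual_blocks.
  (* Here [qlog] of the Cartier dual is [plog M], so both terms involve [J *m Upsilon A (plog M)],
     with opposite signs. *)
  - rewrite tr_row_mx -mulmxA mul_row_col mulNmx /Upsilon; exact: addNr.
  - exact: legendre_relation.
  (* Compatibility of the branches in matrix form. In the block identity this cancels the [logF],
     and the common [ell] cancel each other. *)
  - have EF : hlog_mx A (plog M) *m (log_mx (qlog M))^T
        - log_mx (plog M) *m (hlog_mx A (qlog M))^T = logF D - (logF D')^T.
      apply/matrixP => i k; rewrite !mxE logF_eq sumrB.
      by congr (_ - _); apply: eq_bigr => j _; rewrite !mxE // mulrC.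
    have EL : (ell D' - logF D')^T = ell D - (logF D')^T.
      by apply/matrixP => i k; rewrite !mxE ell_eq.
    rewrite tr_row_mx linearN /= mul_row_col mulmxN.
    rewrite -[log_mx _ *m _ - _]opprB EF EL.
    by rewrite opprB [logF D - _ + _]addrC !addrA !subrK subrr.
  - rewrite tr_row_mx linearN /= mul_row_col mulmxN /Upsilon /=.
    rewrite -[X in _ + X]opprB.
    exact: subrr.
have [uP dualE] := dual_of_mul t0 PD.
have detP : \det (period_matrix D) = t ^+ (g + s) \/
    \det (period_matrix D) = - t ^+ (g + s).
  apply: (@sign_eq_or _ _ _ (block_perm n (g + g) s)).
  rewrite -det_col_perm period_matrix_blocks det_upper_blocks exprD.
  (* [t ^+ (g + g)] is the square of [t ^+ g], so the determinant of the torus block is [t ^+ g] up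
     to sign; [t ^+ s] comes from the block of [del]. *)
  have /eqP := det_period_sqr A; rewrite exprD -expr2 eqf_sqr => /orP[]/eqP ->.
    by left.
  by right; rewrite mulNr.
split=> //.
have tg0 : t ^+ (g + s) != 0 by rewrite expf_neq0.
(* The two determinants multiply to [t ^+ (n + (g + g) + s)]; dividing by the first, known up to
   sign, leaves [t ^+ (n + g)] up to sign. *)
have := congr1 determinant PD; rewrite det_mulmx det_tr det_scalar.
have -> : t ^+ (n + (g + g) + s) = t ^+ (g + s) * t ^+ (n + g).
  by rewrite -exprD; congr (t ^+ _); lia.
case: detP => ->; first by move=> /(mulfI tg0) ->; left.
by rewrite mulNr -mulrN => /(mulfI tg0) <-; right; rewrite opprK.
Qed.
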